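(* Let $H=\{z\in\mathbb{C}:\mathrm{Im}\,z>0\}$. Let $f$ be an injective holomorphic function on $H$ which extends as a $C^1$ function to the closed half-plane $\overline{H}=\{\mathrm{Im}\,z\geq 0\}$, and let $c>0$. Then: (1) if $|f'|\leq c$ on $\mathbb{R}$, then $|f'|\leq c$ in $H$; (2) if $|f'|\geq c$ on $\mathbb{R}$, then $|f'|\geq c$ in $H$; (3) if $|f'|$ is constant on $\mathbb{R}$, then $f'$ is constant in $H$. *)

(* Defs.v *)
From Stdlib Require Import Reals.
Open Scope R_scope.

Definition Cplx : Type := (R * R)%type.
Definition Re (z : Cplx) : R := fst z.
Definition Im (z : Cplx) : R := snd z.
Definition Cadd (z w : Cplx) : Cplx := (Re z + Re w, Im z + Im w).
Definition Csub (z w : Cplx) : Cplx := (Re z - Re w, Im z - Im w).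
Definition Cmul (z w : Cplx) : Cplx :=
  (Re z * Re w - Im z * Im w, Re z * Im w + Im z * Re w).
Definition Cscal (a : R) (z : Cplx) : Cplx := (a * Re z, a * Im z).
Definition Cnorm (z : Cplx) : R := sqrt (Re z ^ 2 + Im z ^ 2).

Definition inH (z : Cplx) : Prop := 0 < Im z.
Definition inHbar (z : Cplx) : Prop := 0 <= Im z.

Definition is_cderiv (f : Cplx -> Cplx) (z L : Cplx) : Prop :=
  forall eps : R, 0 < eps -> exists delta : R, 0 < delta /\
    forall w : Cplx, Cnorm (Csub w z) < delta ->
      Cnorm (Csub (Csub (f w) (f z)) (Cmul L (Csub w z)))
        <= eps * Cnorm (Csub w z).

Definition holomorphic_on_H (f : Cplx -> Cplx) : Prop :=
  forall z, inH z -> exists L, is_cderiv f z L.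

Definition injective_on_H (f : Cplx -> Cplx) : Prop :=
  forall z w, inH z -> inH w -> f z = f w -> z = w.

Definition continuous_on_Hbar (g : Cplx -> Cplx) : Prop :=
  forall z, inHbar z -> forall eps : R, 0 < eps -> exists delta : R, 0 < delta /\
    forall w, inHbar w -> Cnorm (Csub w z) < delta ->
      Cnorm (Csub (g w) (g z)) < eps.

Definition real_diff_Hbar (f : Cplx -> Cplx) (fx fy : Cplx) (z : Cplx) : Prop :=
  forall eps : R, 0 < eps -> exists delta : R, 0 < delta /\
    forall w, inHbar w -> Cnorm (Csub w z) < delta ->
      Cnorm (Csub (Csub (f w) (f z))
                  (Cadd (Cscal (Re (Csub w z)) fx) (Cscal (Im (Csub w z)) fy)))
        <= eps * Cnorm (Csub w z).

Definition C1_on_Hbar (f Fx Fy : Cplx -> Cplx) : Prop :=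
  (forall z, inHbar z -> real_diff_Hbar f (Fx z) (Fy z) z) /\
  continuous_on_Hbar Fx /\ continuous_on_Hbar Fy.

(* Main.v *)
From Stdlib Require Import Reals Lra Lia Psatz Classical ClassicalEpsilon.
From Coquelicot Require Import Coquelicot.
Require Import Defs.
Open Scope R_scope.

(** For real [h > 0] the quotients [(f (z + h) - f z) / h] are holomorphic and, by injectivity, nowhere zero on the
    half-plane, and they converge to [f'] uniformly on compact subsets of the closed half-plane; hence the maximum
    principle on rectangles is available for [f'] and, since [f'] has no zeros, for [1 / f'].  A qualitative Koebe
    distortion theorem bounds [|f' w| / |f' z|] above and below when [|w - z|] is a small multiple of [Im z], and
    chaining it gives [|f'|^{+-1} <= A r^(2p) / y^p] on the rectangle [[-r, r] x [0, r]].  This is enough for a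
    Phragmen-Lindelof argument, which yields (1) for [f'] and (2) from [1 / f'].  For (3), [|f'|] is constant on the
    half-plane by (1) and (2), and the equality case of the mean value property for the slopes
    [(f w - f z) / (w - z)] makes [f] affine. *)

(** * Differentiable functions of a complex variable *)

(** Boundary values alone do not control the interior: [exp (- i z)] has modulus 1 on the real line
    and [exp y] at height [y]. What excludes it as a derivative is injectivity, its primitives being
    periodic; the Koebe theorem is the device that converts injectivity into polynomial growth.
    Since only some finite exponent is required, every constant on the way is crude and squares can
    replace discs. The other obstacle is regularity. [f] has one complex derivative, continuous by
    the C1 hypothesis, and neither Cauchy's formula nor power series are developed, so [f'] is never
    shown to be differentiable. Each function submitted to the maximum principle is therefore built
    directly from [f] (a slope, a reciprocal of a slope, a square root, a difference quotient) or is
    a uniform limit of such functions. Slopes are moreover treated as merely continuous at their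
    base point, which is why the mean value property is proved for a punctured disc. *)

Definition contAt (D : C -> Prop) (g : C -> C) (z : C) : Prop :=
  forall eps : R, 0 < eps -> exists d : R, 0 < d /\
    forall w, D w -> Cmod (w - z)%C < d -> Cmod (g w - g z)%C < eps.

Definition full : C -> Prop := fun _ => True.

(** Continuity of the derivative is built in because it permits differentiation under the integral
    sign in the mean value property, in place of a Goursat-type argument. For [f] it comes from the
    C1 hypothesis. *)
Definition hol (g : C -> C) (P : C -> Prop) : Prop :=
  exists g' : C -> C, forall z, P z -> is_cderiv g z (g' z) /\ contAt full g' z.

Lemma Cmod_sub_sym (z w : C) : Cmod (z - w)%C = Cmod (w - z)%C.
Proof. rewrite <- (Cmod_opp (z - w)%C). f_equal. ring. Qed.

Lemma Cmod_sub_self (z : C) : Cmod (z - z)%C = 0.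
Proof. replace (z - z)%C with (RtoC 0) by ring. apply Cmod_0. Qed.

Lemma Cmod_triangle_sub (z w : C) : Cmod z <= Cmod w + Cmod (z - w)%C.
Proof. replace z with (w + (z - w))%C at 1 by ring. apply Cmod_triangle. Qed.

Lemma Cmod_sub_triangle (x y z : C) :
  Cmod (x - z)%C <= Cmod (x - y)%C + Cmod (y - z)%C.
Proof. replace (x - z)%C with ((x - y) + (y - z))%C by ring. apply Cmod_triangle. Qed.

Lemma Cmod_sqr (z : C) : Cmod z ^ 2 = fst z ^ 2 + snd z ^ 2.
Proof. unfold Cmod. rewrite pow2_sqrt; [reflexivity | nra]. Qed.

Lemma Cmod_le_sqr (z : C) (M : R) : 0 <= M -> fst z ^ 2 + snd z ^ 2 <= M ^ 2 -> Cmod z <= M.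
Proof. intros h h1. rewrite <- Cmod_sqr in h1. pose proof (Cmod_ge_0 z). nra. Qed.

Lemma Rabs_fst_le_Cmod (z : C) : Rabs (fst z) <= Cmod z.
Proof. eapply Rle_trans; [apply Rmax_l | apply Rmax_Cmod]. Qed.

Lemma Rabs_snd_le_Cmod (z : C) : Rabs (snd z) <= Cmod z.
Proof. eapply Rle_trans; [apply Rmax_r | apply Rmax_Cmod]. Qed.

Lemma Cmod_le_Rabs (z : C) : Cmod z <= Rabs (fst z) + Rabs (snd z).
Proof.
apply Cmod_le_sqr.
- pose proof (Rabs_pos (fst z)); pose proof (Rabs_pos (snd z)); lra.
- rewrite <- (pow2_abs (fst z)), <- (pow2_abs (snd z)).
  pose proof (Rabs_pos (fst z)); pose proof (Rabs_pos (snd z)); nra.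
Qed.

Lemma contAt_subset (D E : C -> Prop) g z :
  (forall w, E w -> D w) -> contAt D g z -> contAt E g z.
Proof.
intros hDE hg eps he. destruct (hg eps he) as [d [hd h]]. exists d; split; auto.
Qed.

Lemma contAt_full D g z : contAt full g z -> contAt D g z.
Proof. apply contAt_subset. intros; exact I. Qed.

Lemma contAt_ext (D : C -> Prop) f g z :
  (forall w, D w -> f w = g w) -> f z = g z -> contAt D f z -> contAt D g z.
Proof.
intros hfg hz hf eps he. destruct (hf eps he) as [d [hd h]]. exists d; split; auto.
intros w hw hwd. rewrite <- hfg, <- hz by auto. auto.
Qed.

Lemma contAt_const D (k z : C) : contAt D (fun _ => k) z.
Proof. intros eps he. exists 1; split; [lra|]. intros. rewrite Cmod_sub_self. auto. Qed.

Lemma contAt_id D (z : C) : contAt D (fun w => w) z.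
Proof. intros eps he. exists eps; split; auto. Qed.

Lemma contAt_plus D f g z : contAt D f z -> contAt D g z -> contAt D (fun w => f w + g w)%C z.
Proof.
intros hf hg eps he.
destruct (hf (eps/2)) as [d1 [hd1 h1]]; [lra|]. destruct (hg (eps/2)) as [d2 [hd2 h2]]; [lra|].
exists (Rmin d1 d2); split; [apply Rmin_pos; auto|]. intros w hw hwd.
pose proof (Rmin_l d1 d2); pose proof (Rmin_r d1 d2).
replace (f w + g w - (f z + g z))%C with ((f w - f z) + (g w - g z))%C by ring.
eapply Rle_lt_trans; [apply Cmod_triangle|].
specialize (h1 w hw ltac:(lra)); specialize (h2 w hw ltac:(lra)); lra.
Qed.

Lemma contAt_mult D f g z : contAt D f z -> contAt D g z -> contAt D (fun w => f w * g w)%C z.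
Proof.
intros hf hg eps he.
set (A := Cmod (f z)). set (B := Cmod (g z)).
assert (hA : 0 <= A) by apply Cmod_ge_0. assert (hB : 0 <= B) by apply Cmod_ge_0.
set (e := Rmin 1 (eps / (A + B + 1))).
assert (he' : 0 < e) by (apply Rmin_pos; [lra | apply Rdiv_lt_0_compat; lra]).
assert (he1 : e <= 1) by apply Rmin_l.
assert (he2 : e * (A + B + 1) <= eps).
{ apply Rle_trans with (eps / (A + B + 1) * (A + B + 1)).
  - apply Rmult_le_compat_r; [lra | apply Rmin_r].
  - right; field; lra. }
destruct (hf e he') as [d1 [hd1 h1]]. destruct (hg e he') as [d2 [hd2 h2]].
exists (Rmin d1 d2); split; [apply Rmin_pos; auto|]. intros w hw hwd.
pose proof (Rmin_l d1 d2); pose proof (Rmin_r d1 d2).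
specialize (h1 w hw ltac:(lra)); specialize (h2 w hw ltac:(lra)).
replace (f w * g w - f z * g z)%C
  with ((f w - f z) * (g w - g z) + (f z * (g w - g z) + (f w - f z) * g z))%C by ring.
eapply Rle_lt_trans; [apply Cmod_triangle|].
eapply Rle_lt_trans; [apply Rplus_le_compat_l, Cmod_triangle|].
rewrite !Cmod_mult. fold A B.
pose proof (Cmod_ge_0 (f w - f z)%C). pose proof (Cmod_ge_0 (g w - g z)%C).
nra.
Qed.

Lemma contAt_away_from_0 D f z : contAt D f z -> f z <> (RtoC 0) ->
  exists d, 0 < d /\ (forall w, D w -> Cmod (w - z)%C < d -> Cmod (f z) / 2 < Cmod (f w)).
Proof.
intros hf hz. apply Cmod_gt_0 in hz.
destruct (hf (Cmod (f z) / 2)) as [d [hd h]]; [lra|].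
exists d; split; auto. intros w hw hwd. specialize (h w hw hwd).
pose proof (Cmod_triangle_sub (f z) (f w)). rewrite Cmod_sub_sym in h. lra.
Qed.

Lemma contAt_Cinv D f z : contAt D f z -> f z <> (RtoC 0) -> contAt D (fun w => / f w)%C z.
Proof.
intros hf hz eps he. destruct (contAt_away_from_0 D f z hf hz) as [d1 [hd1 h1]].
assert (hz' := hz). apply Cmod_gt_0 in hz'. set (A := Cmod (f z)) in *.
destruct (hf (eps * (A * A / 2))) as [d2 [hd2 h2]]; [apply Rmult_lt_0_compat; nra|].
exists (Rmin d1 d2); split; [apply Rmin_pos; auto|]. intros w hw hwd.
pose proof (Rmin_l d1 d2); pose proof (Rmin_r d1 d2).
specialize (h1 w hw ltac:(lra)); specialize (h2 w hw ltac:(lra)).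
assert (hw0 : f w <> (RtoC 0)) by (apply Cmod_gt_0; lra).
replace (/ f w - / f z)%C with (- (f w - f z) * / (f w * f z))%C by (field; auto).
rewrite Cmod_mult, Cmod_opp, Cmod_inv, Cmod_mult by (apply Cmult_neq_0; auto).
fold A. set (B := Cmod (f w)) in *.
apply Rmult_lt_reg_r with (B * A); [nra|].
replace (Cmod (f w - f z) * / (B * A) * (B * A)) with (Cmod (f w - f z)%C) by (field; lra).
eapply Rlt_le_trans; [apply h2|]. apply Rmult_le_compat_l; [lra|]. nra.
Qed.

Lemma contAt_minus D f g z : contAt D f z -> contAt D g z -> contAt D (fun w => f w - g w)%C z.
Proof.
intros hf hg. apply contAt_ext with (fun w => f w + (- RtoC 1) * g w)%C.
- intros w _. ring.
- ring.
- apply contAt_plus; auto. apply contAt_mult; auto. apply contAt_const.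
Qed.

Lemma contAt_comp D E f g z : (forall w, D w -> E (g w)) ->
  contAt D g z -> contAt E f (g z) -> contAt D (fun w => f (g w)) z.
Proof.
intros hDE hg hf eps he. destruct (hf eps he) as [d1 [hd1 h1]].
destruct (hg d1 hd1) as [d2 [hd2 h2]]. exists d2; split; auto.
Qed.

Lemma contAt_pow D f z n : contAt D f z -> contAt D (fun w => f w ^ n)%C z.
Proof.
intros hf. induction n as [|n IH]; simpl; [apply contAt_const | apply contAt_mult; auto].
Qed.

Lemma contAt_locally (D : C -> Prop) g z r : 0 < r ->
  (forall w, Cmod (w - z)%C < r -> D w) -> contAt D g z -> contAt full g z.
Proof.
intros hr hD hg eps he. destruct (hg eps he) as [d [hd h]].
exists (Rmin d r); split; [apply Rmin_pos; auto|]. intros w _ hw.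
pose proof (Rmin_l d r); pose proof (Rmin_r d r). apply h; [apply hD|]; lra.
Qed.

Lemma contAt_ext_loc (f g : C -> C) z r : 0 < r ->
  (forall w, Cmod (w - z)%C < r -> f w = g w) -> contAt full f z -> contAt full g z.
Proof.
intros hr hD hg eps he. destruct (hg eps he) as [d [hd h]].
exists (Rmin d r); split; [apply Rmin_pos; auto|]. intros w _ hw.
pose proof (Rmin_l d r); pose proof (Rmin_r d r).
rewrite <- !hD; [apply h; [exact I|] | rewrite Cmod_sub_self |]; lra.
Qed.

(** The slope of [f] at the base point [b], with the singularity filled in by [L]. If [L] is the
    derivative at [b], the slope is continuous there, and this is all that the maximum principle
    below asks for at [b]. *)
Definition dq (f : C -> C) (L b : C) (w : C) : C :=
  if excluded_middle_informative (w = b) then L else ((f w - f b) / (w - b))%C.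

Lemma dq_at f L b : dq f L b b = L.
Proof. unfold dq. destruct excluded_middle_informative; congruence. Qed.

Lemma Csub_neq_0 (z w : C) : z <> w -> (z - w)%C <> (RtoC 0).
Proof. intros h e. apply h. replace z with ((z - w) + w)%C by ring. rewrite e. ring. Qed.

Lemma dq_neq f L b w : w <> b -> dq f L b w = ((f w - f b) / (w - b))%C.
Proof. intros h. unfold dq. destruct excluded_middle_informative; congruence. Qed.

Lemma dq_mult f L b w : (f w - f b = dq f L b w * (w - b))%C.
Proof.
unfold dq. destruct excluded_middle_informative as [->|h]; [ring|].
field. apply Csub_neq_0; auto.
Qed.

Lemma is_cderiv_eq (f : C -> C) (z L : C) : is_cderiv f z L <->
  forall eps : R, 0 < eps -> exists d : R, 0 < d /\ forall w : C, Cmod (w - z)%C < d ->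
    Cmod (f w - f z - L * (w - z))%C <= eps * Cmod (w - z)%C.
Proof. split; intros h; exact h. Qed.

Lemma cderiv_dq f z L : is_cderiv f z L <-> contAt full (dq f L z) z.
Proof.
rewrite is_cderiv_eq. split.
- intros hf eps he. destruct (hf (eps/2)) as [d [hd h]]; [lra|]. exists d; split; auto.
  intros w _ hw. rewrite dq_at. unfold dq.
  destruct excluded_middle_informative as [->|hne].
  + rewrite Cmod_sub_self; auto.
  + specialize (h w hw). apply Csub_neq_0 in hne. assert (h0 := hne). apply Cmod_gt_0 in h0.
    replace ((f w - f z) / (w - z) - L)%C with ((f w - f z - L * (w - z)) / (w - z))%C
      by (field; auto).
    rewrite Cmod_div by auto. apply Rmult_lt_reg_r with (Cmod (w - z)%C); auto.
    unfold Rdiv. rewrite Rmult_assoc, Rinv_l by lra. nra.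
- intros hf eps he. destruct (hf eps he) as [d [hd h]]. exists d; split; auto.
  intros w hw. rewrite (dq_mult f L z w). specialize (h w I hw). rewrite dq_at in h.
  replace (dq f L z w * (w - z) - L * (w - z))%C with ((dq f L z w - L) * (w - z))%C by ring.
  rewrite Cmod_mult. apply Rmult_le_compat_r; [apply Cmod_ge_0 | lra].
Qed.

(** Caratheodory's form of differentiability: the increment factors through a function continuous at
    [z]. Each rule below, up to the differentiability of square roots, is proved by exhibiting this
    factor. *)
Lemma cderiv_intro f z phi r : 0 < r -> contAt full phi z ->
  (forall w, Cmod (w - z)%C < r -> w <> z -> (f w - f z = phi w * (w - z))%C) ->
  is_cderiv f z (phi z).
Proof.
intros hr hphi h. apply cderiv_dq. apply contAt_ext_loc with phi r; auto.
intros w hw. unfold dq. destruct excluded_middle_informative as [->|hne]; auto.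
rewrite h by auto. field. apply Csub_neq_0; auto.
Qed.

Lemma cderiv_cont f z L : is_cderiv f z L -> contAt full f z.
Proof.
intros hf. apply cderiv_dq in hf.
apply contAt_ext with (fun w => f z + dq f L z w * (w - z))%C.
- intros w _. rewrite <- dq_mult. ring.
- ring.
- apply contAt_plus; [apply contAt_const|]. apply contAt_mult; auto.
  apply contAt_minus; [apply contAt_id | apply contAt_const].
Qed.

Lemma cderiv_const (k z : C) : is_cderiv (fun _ => k) z (RtoC 0).
Proof.
apply (cderiv_intro _ z (fun _ => (RtoC 0)) 1); [lra | apply contAt_const |]. intros; ring.
Qed.

Lemma cderiv_id (z : C) : is_cderiv (fun w => w) z (RtoC 1).
Proof.
apply (cderiv_intro _ z (fun _ => (RtoC 1)) 1); [lra | apply contAt_const |]. intros; ring.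
Qed.

Lemma cderiv_plus f g z L M : is_cderiv f z L -> is_cderiv g z M ->
  is_cderiv (fun w => (f w + g w)%C) z (L + M)%C.
Proof.
intros hf hg. apply cderiv_dq in hf. apply cderiv_dq in hg.
rewrite <- (dq_at f L z) at 1. rewrite <- (dq_at g M z) at 1.
apply (cderiv_intro _ z (fun w => dq f L z w + dq g M z w)%C 1); [lra | apply contAt_plus; auto |].
intros w _ _. rewrite Cmult_plus_distr_r, <- !dq_mult. ring.
Qed.

Lemma cderiv_mult f g z L M : is_cderiv f z L -> is_cderiv g z M ->
  is_cderiv (fun w => f w * g w)%C z (L * g z + f z * M)%C.
Proof.
intros hf hg. assert (hc := cderiv_cont _ _ _ hg). apply cderiv_dq in hf. apply cderiv_dq in hg.
rewrite <- (dq_at f L z) at 1. rewrite <- (dq_at g M z) at 1.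
apply (cderiv_intro _ z (fun w => dq f L z w * g w + f z * dq g M z w)%C 1); [lra | |].
- apply contAt_plus; apply contAt_mult; auto. apply contAt_const.
- intros w _ _.
  replace ((dq f L z w * g w + f z * dq g M z w) * (w - z))%C
   with ((dq f L z w * (w - z)) * g w + f z * (dq g M z w * (w - z)))%C by ring.
  rewrite <- !dq_mult. ring.
Qed.

Lemma cderiv_inv f z L : is_cderiv f z L -> f z <> (RtoC 0) ->
  is_cderiv (fun w => / f w)%C z (- L / (f z * f z))%C.
Proof.
intros hf h0. assert (hc := cderiv_cont _ _ _ hf). apply cderiv_dq in hf.
destruct (contAt_away_from_0 _ _ _ hc h0) as [d [hd h]].
rewrite <- (dq_at f L z) at 1.
apply (cderiv_intro _ z (fun w => - dq f L z w / (f w * f z))%C d); auto.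
- apply contAt_mult.
  + apply contAt_ext with (fun w => 0 - dq f L z w)%C; try (intros; ring).
    apply contAt_minus; auto. apply contAt_const.
  + apply contAt_Cinv; [apply contAt_mult; auto; apply contAt_const | apply Cmult_neq_0; auto].
- intros w hw _. specialize (h w I hw).
  assert (f w <> (RtoC 0)) by (apply Cmod_gt_0; pose proof (Cmod_ge_0 (f z)); lra).
  replace (- dq f L z w / (f w * f z) * (w - z))%C
    with (- (dq f L z w * (w - z)) / (f w * f z))%C by (field; auto).
  rewrite <- dq_mult. field. auto.
Qed.

Lemma cderiv_unique f z L M : is_cderiv f z L -> is_cderiv f z M -> L = M.
Proof.
intros hL hM. apply NNPP. intros hne. apply Csub_neq_0, Cmod_gt_0 in hne.
destruct (proj1 (is_cderiv_eq _ _ _) hL (Cmod (L - M)%C / 4)) as [d1 [hd1 h1]]; [lra|].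
destruct (proj1 (is_cderiv_eq _ _ _) hM (Cmod (L - M)%C / 4)) as [d2 [hd2 h2]]; [lra|].
set (d := Rmin d1 d2 / 2). assert (hd : 0 < Rmin d1 d2) by (apply Rmin_pos; auto).
pose proof (Rmin_l d1 d2); pose proof (Rmin_r d1 d2).
assert (hw : Cmod (z + RtoC d - z)%C = d).
{ replace (z + RtoC d - z)%C with (RtoC d) by ring. rewrite Cmod_R, Rabs_pos_eq; unfold d; lra. }
specialize (h1 (z + RtoC d)%C ltac:(rewrite hw; unfold d; lra)).
specialize (h2 (z + RtoC d)%C ltac:(rewrite hw; unfold d; lra)).
rewrite hw in h1, h2.
assert (h3 : Cmod ((L - M) * (z + RtoC d - z))%C <= Cmod (L - M)%C / 4 * d + Cmod (L - M)%C / 4 * d).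
{ set (w := (z + RtoC d)%C) in *.
  replace ((L - M) * (w - z))%C with
   ((f w - f z - M * (w - z)) - (f w - f z - L * (w - z)))%C by ring.
  eapply Rle_trans; [apply Cmod_triangle|]. rewrite Cmod_opp. lra. }
rewrite Cmod_mult, hw in h3. unfold d in h3. nra.
Qed.

Lemma cderiv_ext_loc (f g : C -> C) z L r : 0 < r ->
  (forall w, Cmod (w - z)%C < r -> f w = g w) -> is_cderiv f z L -> is_cderiv g z L.
Proof.
intros hr h hf. apply cderiv_dq in hf. rewrite <- (dq_at f L z).
apply (cderiv_intro _ _ _ r); auto. intros w hw _.
rewrite <- dq_mult, !h; auto. rewrite Cmod_sub_self; auto.
Qed.

Lemma cderiv_shift f (k z L : C) : is_cderiv f (z + k)%C L -> is_cderiv (fun w => f (w + k)%C) z L.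
Proof.
rewrite !is_cderiv_eq. intros hf eps he. destruct (hf eps he) as [d [hd h]].
exists d; split; auto. intros w hw. specialize (h (w + k)%C).
replace (w + k - (z + k))%C with (w - z)%C in h by ring. auto.
Qed.

(** * Closure properties of C1 holomorphic functions *)

Lemma hol_subset g (P Q : C -> Prop) : (forall z, Q z -> P z) -> hol g P -> hol g Q.
Proof. intros h [g' hg]. exists g'. auto. Qed.

Lemma hol_cont g P z : hol g P -> P z -> contAt full g z.
Proof. intros [g' h] hz. apply (cderiv_cont _ _ (g' z)), h, hz. Qed.

Lemma hol_const (k : C) P : hol (fun _ => k) P.
Proof. exists (fun _ => (RtoC 0)). intros; split; [apply cderiv_const | apply contAt_const]. Qed.

Lemma hol_id P : hol (fun w => w) P.
Proof. exists (fun _ => (RtoC 1)). intros; split; [apply cderiv_id | apply contAt_const]. Qed.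

Lemma hol_plus f g P : hol f P -> hol g P -> hol (fun w => f w + g w)%C P.
Proof.
intros [f' hf] [g' hg]. exists (fun z => f' z + g' z)%C. intros z hz.
destruct (hf z hz), (hg z hz). split; [apply cderiv_plus | apply contAt_plus]; auto.
Qed.

Lemma hol_mult f g P : hol f P -> hol g P -> hol (fun w => f w * g w)%C P.
Proof.
intros [f' hf] [g' hg]. exists (fun z => f' z * g z + f z * g' z)%C. intros z hz.
destruct (hf z hz), (hg z hz). split; [apply cderiv_mult; auto|].
apply contAt_plus; apply contAt_mult; eauto using cderiv_cont.
Qed.

Lemma hol_minus f g P : hol f P -> hol g P -> hol (fun w => f w - g w)%C P.
Proof.
intros hf hg. apply (hol_plus f (fun w => - g w)%C); auto.
destruct (hol_mult _ _ P (hol_const (- RtoC 1)%C P) hg) as [h' h].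
exists h'. intros z hz. destruct (h z hz). split; auto.
apply (cderiv_ext_loc (fun w => - RtoC 1 * g w)%C _ z _ 1); auto; [lra|].
intros. ring.
Qed.

Lemma hol_inv f P : hol f P -> (forall z, P z -> f z <> (RtoC 0)) -> hol (fun w => / f w)%C P.
Proof.
intros [f' hf] h0. exists (fun z => - f' z / (f z * f z))%C. intros z hz.
destruct (hf z hz). split; [apply cderiv_inv; auto|].
assert (contAt full f z) by eauto using cderiv_cont.
apply contAt_mult.
- apply contAt_ext with (fun w => 0 - f' w)%C; try (intros; ring).
  apply contAt_minus; auto. apply contAt_const.
- apply contAt_Cinv; [apply contAt_mult; auto | apply Cmult_neq_0; auto].
Qed.

Lemma hol_div f g P : hol f P -> hol g P -> (forall z, P z -> g z <> (RtoC 0)) ->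
  hol (fun w => f w / g w)%C P.
Proof. intros hf hg h0. apply hol_mult; auto. apply hol_inv; auto. Qed.

Lemma hol_pow f n P : hol f P -> hol (fun w => f w ^ n)%C P.
Proof.
intros hf. induction n as [|n IH]; simpl; [apply hol_const | apply hol_mult; auto].
Qed.

Lemma hol_shift f (k : C) P : hol f P -> hol (fun w => f (w + k)%C) (fun w => P (w + k)%C).
Proof.
intros [f' hf]. exists (fun w => f' (w + k)%C). intros z hz. destruct (hf _ hz).
split; [apply cderiv_shift; auto|].
apply (contAt_comp full full); auto. apply contAt_plus; [apply contAt_id | apply contAt_const].
Qed.

Definition Copen (P : C -> Prop) : Prop :=
  forall z, P z -> exists r, 0 < r /\ forall w, Cmod (w - z)%C < r -> P w.

Lemma hol_ext f g P : Copen P -> (forall z, P z -> f z = g z) -> hol f P -> hol g P.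
Proof.
intros ho hfg [f' hf]. exists f'. intros z hz. destruct (hf z hz). split; auto.
destruct (ho z hz) as [r [hr h]]. apply cderiv_ext_loc with f r; auto.
Qed.

Lemma Copen_punctured P b : Copen P -> Copen (fun z => P z /\ z <> b).
Proof.
intros ho z [hz hb]. destruct (ho z hz) as [r [hr h]].
apply Csub_neq_0, Cmod_gt_0 in hb.
exists (Rmin r (Cmod (z - b)%C)); split; [apply Rmin_pos; auto|].
intros w hw. pose proof (Rmin_l r (Cmod (z - b)%C)); pose proof (Rmin_r r (Cmod (z - b)%C)).
split; [apply h; lra|]. intros ->. rewrite Cmod_sub_sym in hw. lra.
Qed.

Lemma dq_hol f L b P : Copen P -> hol f P -> hol (dq f L b) (fun z => P z /\ z <> b).
Proof.
intros ho hf. apply hol_ext with (fun w => (f w - f b) / (w - b))%C.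
- apply Copen_punctured; auto.
- intros z [_ hz]. rewrite dq_neq; auto.
- apply hol_div.
  + apply hol_minus; [|apply hol_const]. apply hol_subset with P; auto. tauto.
  + apply hol_minus; [apply hol_id | apply hol_const].
  + intros z [_ hz]. apply Csub_neq_0; auto.
Qed.

Lemma dq_cont f L b P z : Copen P -> hol f P -> is_cderiv f b L -> P z -> contAt full (dq f L b) z.
Proof.
intros ho hf hb hz. destruct (classic (z = b)) as [->|hne].
- apply cderiv_dq; auto.
- apply (hol_cont _ _ z (dq_hol f L b P ho hf)); auto.
Qed.

Lemma pair_eq (z w : C) : fst z = fst w -> snd z = snd w -> z = w.
Proof. destruct z, w; simpl; congruence. Qed.

(** * The mean value property *)

Lemma contAt_2d g (x y : R) : contAt full g (x, y) <->
  continuity_2d_pt (fun u v => fst (g (u, v))) x y /\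
  continuity_2d_pt (fun u v => snd (g (u, v))) x y.
Proof.
split.
- intros hg. split; intros eps; destruct (hg eps (cond_pos eps)) as [d [hd h]];
  assert (hd2 : 0 < d / 2) by lra; exists (mkposreal _ hd2); simpl; intros u v hu hv;
  specialize (h (u, v) I);
  pose proof (Cmod_le_Rabs ((u, v) - (x, y))%C) as h1; simpl in h1;
  specialize (h ltac:(unfold Rminus in hu, hv; lra)).
  + eapply Rle_lt_trans; [|apply h].
    apply (Rabs_fst_le_Cmod (g (u, v) - g (x, y))%C).
  + eapply Rle_lt_trans; [|apply h].
    apply (Rabs_snd_le_Cmod (g (u, v) - g (x, y))%C).
- intros [h1 h2] eps he. assert (he2 : 0 < eps / 2) by lra.
  destruct (h1 (mkposreal _ he2)) as [d1 k1]. destruct (h2 (mkposreal _ he2)) as [d2 k2].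
  exists (Rmin d1 d2). split; [apply Rmin_pos; apply cond_pos|].
  intros [u v] _ hw. pose proof (Rmin_l d1 d2); pose proof (Rmin_r d1 d2).
  pose proof (Rabs_fst_le_Cmod ((u, v) - (x, y))%C) as h3.
  pose proof (Rabs_snd_le_Cmod ((u, v) - (x, y))%C) as h4. simpl in h3, h4.
  specialize (k1 u v ltac:(unfold Rminus; lra) ltac:(unfold Rminus; lra)).
  specialize (k2 u v ltac:(unfold Rminus; lra) ltac:(unfold Rminus; lra)). simpl in k1, k2.
  eapply Rle_lt_trans; [apply Cmod_le_Rabs|]. simpl. unfold Rminus in k1, k2. lra.
Qed.

(** The Cauchy-Riemann equations: multiplication by [L] is the real matrix with rows
    [(fst L, - snd L)] and [(snd L, fst L)]. *)
Lemma cderiv_differentiable G (x y : R) (L : C) : is_cderiv G (x, y) L ->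
  differentiable_pt_lim (fun u v => fst (G (u, v))) x y (fst L) (- snd L) /\
  differentiable_pt_lim (fun u v => snd (G (u, v))) x y (snd L) (fst L).
Proof.
rewrite is_cderiv_eq. intros hG. split; intros eps;
  (destruct (hG (eps / 2)) as [d [hd h]]; [pose proof (cond_pos eps); lra|]);
  assert (hd2 : 0 < d / 2) by lra; exists (mkposreal _ hd2); simpl; intros u v hu hv;
  specialize (h (u, v));
  pose proof (Cmod_le_Rabs ((u, v) - (x, y))%C) as h1; simpl in h1;
  specialize (h ltac:(unfold Rminus in hu, hv; lra));
  (assert (h2 : eps / 2 * Cmod ((u, v) - (x, y))%C <= eps * Rmax (Rabs (u - x)) (Rabs (v - y)));
   [ pose proof (Rmax_l (Rabs (u - x)) (Rabs (v - y)));
     pose proof (Rmax_r (Rabs (u - x)) (Rabs (v - y)));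
     pose proof (cond_pos eps); unfold Rminus in *; nra |]);
  eapply Rle_trans; [|apply h2| |apply h2]; (eapply Rle_trans; [|apply h]).
- eapply Rle_trans; [|apply Rabs_fst_le_Cmod]. right. f_equal. simpl. ring.
- eapply Rle_trans; [|apply Rabs_snd_le_Cmod]. right. f_equal. simpl. ring.
Qed.

Lemma cderiv_curve G (x y : R -> R) t x' y' (L : C) :
  is_derive x t x' -> is_derive y t y' -> is_cderiv G (x t, y t) L ->
  is_derive (fun s => fst (G (x s, y s))) t (fst L * x' - snd L * y') /\
  is_derive (fun s => snd (G (x s, y s))) t (snd L * x' + fst L * y').
Proof.
intros hx hy hG. apply cderiv_differentiable in hG. destruct hG as [h1 h2].
apply is_derive_Reals in hx. apply is_derive_Reals in hy.
split; apply is_derive_Reals.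
- replace (fst L * x' - snd L * y') with (fst L * x' + (- snd L) * y') by ring.
  apply (derivable_pt_lim_comp_2d (fun u v => fst (G (u, v)))); auto.
- apply (derivable_pt_lim_comp_2d (fun u v => snd (G (u, v)))); auto.
Qed.

Definition circ (z : C) (s t : R) : C := (fst z + s * cos t, snd z + s * sin t).

Lemma circ_dist z s t : 0 <= s -> Cmod (circ z s t - z)%C = s.
Proof.
intros hs. unfold circ, Cmod. simpl.
replace ((fst z + s * cos t + - fst z) * ((fst z + s * cos t + - fst z) * 1) +
   (snd z + s * sin t + - snd z) * ((snd z + s * sin t + - snd z) * 1))
  with (s * s * (Rsqr (sin t) + Rsqr (cos t))) by (unfold Rsqr; ring).
rewrite sin2_cos2, Rmult_1_r. apply sqrt_square; auto.
Qed.

Lemma continuity_pt_2d_comp (F : R -> R -> R) (a b : R -> R) t :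
  continuity_pt a t -> continuity_pt b t -> continuity_2d_pt F (a t) (b t) ->
  continuity_pt (fun s => F (a s) (b s)) t.
Proof.
rewrite !continuity_pt_filterlim. intros ha hb hF.
apply filterlim_locally. intros eps. destruct (hF eps) as [d hd].
pose proof (proj1 (filterlim_locally a _) ha d) as h1.
pose proof (proj1 (filterlim_locally b _) hb d) as h2.
generalize (filter_and _ _ h1 h2). apply filter_imp. intros s [k1 k2]. apply hd; auto.
Qed.

Lemma circ_continuity (g : C -> C) z s t : contAt full g (circ z s t) ->
  continuity_pt (fun t => fst (g (circ z s t))) t /\ continuity_pt (fun t => snd (g (circ z s t))) t.
Proof.
intros hg. apply contAt_2d in hg. destruct hg as [h1 h2].
split; [apply (continuity_pt_2d_comp (fun u v => fst (g (u, v))) (fun t => fst z + s * cos t) (fun t => snd z + s * sin t))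
  | apply (continuity_pt_2d_comp (fun u v => snd (g (u, v))) (fun t => fst z + s * cos t) (fun t => snd z + s * sin t))]; auto; reg.
Qed.

Lemma is_derive_circ_angle g z s t L : is_cderiv g (circ z s t) L ->
  is_derive (fun t => snd (g (circ z s t))) t (s * (fst L * cos t - snd L * sin t)).
Proof.
intros hg.
replace (s * (fst L * cos t - snd L * sin t)) with (snd L * (- (s * sin t)) + fst L * (s * cos t)) by ring.
apply (cderiv_curve g (fun t => fst z + s * cos t) (fun t => snd z + s * sin t)); auto.
- auto_derive; [auto | ring].
- auto_derive; [auto | ring].
Qed.

Lemma is_derive_circ_radius g z s t L : is_cderiv g (circ z s t) L ->
  is_derive (fun s => fst (g (circ z s t))) s (fst L * cos t - snd L * sin t).
Proof.
intros hg.
apply (cderiv_curve g (fun s => fst z + s * cos t) (fun s => snd z + s * sin t)); auto.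
- auto_derive; [auto | ring].
- auto_derive; [auto | ring].
Qed.

Lemma continuity_2d_circ (g : C -> C) z s t : contAt full g (circ z s t) ->
  continuity_2d_pt (fun s t => fst (g (circ z s t))) s t /\
  continuity_2d_pt (fun s t => snd (g (circ z s t))) s t.
Proof.
intros hg.
apply (contAt_2d (fun w => g (circ z (fst w) (snd w))) s t).
apply (contAt_comp full full g (fun w => circ z (fst w) (snd w))).
- exact (fun _ _ => I).
- apply contAt_2d. unfold circ; simpl. split.
  + apply continuity_2d_pt_plus; [apply continuity_2d_pt_const|].
    apply continuity_2d_pt_mult; [apply continuity_2d_pt_id1|].
    apply (continuity_1d_2d_pt_comp cos (fun _ v => v)); [reg | apply continuity_2d_pt_id2].
  + apply continuity_2d_pt_plus; [apply continuity_2d_pt_const|].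
    apply continuity_2d_pt_mult; [apply continuity_2d_pt_id1|].
    apply (continuity_1d_2d_pt_comp sin (fun _ v => v)); [reg | apply continuity_2d_pt_id2].
- exact hg.
Qed.

Lemma circ_ex_RInt g z s a b : (forall t, contAt full g (circ z s t)) ->
  ex_RInt (fun t => fst (g (circ z s t))) a b.
Proof.
intros h. apply (ex_RInt_continuous (V := R_CompleteNormedModule)). intros t _.
apply continuity_pt_filterlim, circ_continuity, h.
Qed.

Lemma circ_2PI z s : circ z s (2 * PI) = circ z s 0.
Proof. unfold circ. rewrite cos_2PI, sin_2PI, cos_0, sin_0. reflexivity. Qed.

(** By the Cauchy-Riemann equations in polar form, the radial derivative of the real part is [/ s]
    times the angular derivative of the imaginary part, and the latter integrates to 0 over a full
    turn. *)
Lemma mean_value_derive g z r s : hol g (fun w => 0 < Cmod (w - z)%C < r) -> 0 < s < r ->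
  is_derive (fun s => RInt (fun t => fst (g (circ z s t))) 0 (2 * PI)) s 0.
Proof.
intros [g' hg] hs.
assert (hin : forall u t, 0 < u < r -> 0 < Cmod (circ z u t - z)%C < r).
{ intros u t hu. rewrite circ_dist; lra. }
assert (hloc : forall P : R -> Prop, (forall u, 0 < u < r -> P u) -> locally s P).
{ intros P hP. assert (hm : 0 < Rmin s (r - s)) by (apply Rmin_pos; lra).
  exists (mkposreal _ hm). intros u hu. apply hP.
  assert (hu' : Rabs (u - s) < Rmin s (r - s)) by exact hu.
  pose proof (Rmin_l s (r - s)); pose proof (Rmin_r s (r - s)).
  apply Rabs_def2 in hu'. lra. }
pose (k := fun u t => fst (g' (circ z u t)) * cos t - snd (g' (circ z u t)) * sin t).
assert (hk : forall u t, 0 < u < r -> is_derive (fun s => fst (g (circ z s t))) u (k u t)).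
{ intros u t hu. apply is_derive_circ_radius, hg, hin, hu. }
assert (hD : is_derive (fun s => RInt (fun t => fst (g (circ z s t))) 0 (2 * PI)) s
  (RInt (fun t => Derive (fun u => fst (g (circ z u t))) s) 0 (2 * PI))).
{ apply is_derive_RInt_param.
  - apply hloc. intros u hu t _. exists (k u t). apply hk, hu.
  - intros t _. apply continuity_2d_pt_ext_loc with k.
    + assert (hm : 0 < Rmin s (r - s)) by (apply Rmin_pos; lra).
      exists (mkposreal _ hm). simpl. intros u v hu _.
      pose proof (Rmin_l s (r - s)); pose proof (Rmin_r s (r - s)).
      apply Rabs_def2 in hu. symmetry. apply is_derive_unique, hk. lra.
    + unfold k. destruct (continuity_2d_circ g' z s t) as [h1 h2]; [apply hg, hin, hs|].
      apply continuity_2d_pt_minus; apply continuity_2d_pt_mult; auto;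
      [apply (continuity_1d_2d_pt_comp cos (fun _ v => v)) |
       apply (continuity_1d_2d_pt_comp sin (fun _ v => v))];
      try apply continuity_2d_pt_id2; reg.
  - apply hloc. intros u hu. apply circ_ex_RInt. intros t.
    eapply cderiv_cont, hg, hin, hu. }
assert (e : RInt (fun t => Derive (fun u => fst (g (circ z u t))) s) 0 (2 * PI) = 0);
  [|rewrite e in hD; exact hD].
assert (hI : is_RInt (fun t => s * k s t) 0 (2 * PI) 0).
{ replace 0 with (minus (snd (g (circ z s (2 * PI)))) (snd (g (circ z s 0)))) at 2
    by (rewrite circ_2PI; unfold minus, plus, opp; simpl; ring).
  apply (is_RInt_derive (V := R_CompleteNormedModule) (fun t => snd (g (circ z s t)))).
  - intros t _. apply is_derive_circ_angle, hg, hin, hs.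
  - intros t _. unfold k. destruct (circ_continuity g' z s t) as [h1 h2]; [apply hg, hin, hs|].
    apply continuity_pt_filterlim.
    apply continuity_pt_mult; [reg|]. apply continuity_pt_minus; apply continuity_pt_mult; auto; reg. }
apply (is_RInt_scal _ _ _ (/ s)) in hI.
rewrite (RInt_ext _ (k s)).
- apply is_RInt_unique. replace 0 with (scal (/ s) 0) at 2 by (unfold scal; simpl; unfold mult; simpl; ring).
  eapply is_RInt_ext; [|apply hI]. intros t _. unfold scal; simpl; unfold mult; simpl. field; lra.
- intros t _. apply is_derive_unique, hk, hs.
Qed.

(** The circular integral does not depend on the radius, so its value is found by shrinking the
    circle, where continuity at the centre suffices. Working with the real part alone is no loss:
    [g] can be multiplied by a constant beforehand, as is done with [Cconj] later. *)
Lemma mean_value g z r s : contAt full g z -> hol g (fun w => 0 < Cmod (w - z)%C < r) -> 0 < s < r ->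
  RInt (fun t => fst (g (circ z s t))) 0 (2 * PI) = 2 * PI * fst (g z).
Proof.
intros hc hg hs. pose proof PI_RGT_0 as hpi.
assert (hcont : forall u t, 0 < u < r -> contAt full g (circ z u t)).
{ intros u t hu. apply (hol_cont g _ _ hg). rewrite circ_dist; lra. }
apply cond_eq. intros eps he.
destruct (hc (eps / (2 * (2 * PI)))) as [d [hd h]]; [apply Rdiv_lt_0_compat; lra|].
set (u := Rmin s d / 2). assert (hm : 0 < Rmin s d) by (apply Rmin_pos; lra).
pose proof (Rmin_l s d); pose proof (Rmin_r s d).
assert (hu : 0 < u < s) by (unfold u; lra).
assert (e : RInt (fun t => fst (g (circ z s t))) 0 (2 * PI) = RInt (fun t => fst (g (circ z u t))) 0 (2 * PI)).
{ symmetry. apply (eq_is_derive (fun s => RInt (fun t => fst (g (circ z s t))) 0 (2 * PI))); [|lra].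
  intros v hv. apply (mean_value_derive g z r v); auto; lra. }
rewrite e.
replace (2 * PI * fst (g z)) with (RInt (fun _ : R => fst (g z)) 0 (2 * PI)).
2:{ rewrite RInt_const. unfold scal; simpl; unfold mult; simpl. ring. }
assert (h1 : ex_RInt (fun t => fst (g (circ z u t))) 0 (2 * PI))
  by (apply circ_ex_RInt; intros; apply hcont; lra).
assert (h2 : ex_RInt (fun _ : R => fst (g z)) 0 (2 * PI)) by apply ex_RInt_const.
assert (ei := RInt_minus (V := R_CompleteNormedModule) _ _ _ _ h1 h2).
change (RInt (fun t => fst (g (circ z u t)) - fst (g z)) 0 (2 * PI) =
  RInt (fun t => fst (g (circ z u t))) 0 (2 * PI) - RInt (fun _ : R => fst (g z)) 0 (2 * PI)) in ei.
rewrite <- ei.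
eapply Rle_lt_trans; [apply abs_RInt_le_const with (M := eps / (2 * (2 * PI)))|].
- lra.
- apply (ex_RInt_minus (V := R_NormedModule) _ _ _ _ h1 h2).
- intros t _. left. eapply Rle_lt_trans; [|apply (h (circ z u t) I)].
  + apply (Rabs_fst_le_Cmod (g (circ z u t) - g z)%C).
  + rewrite circ_dist; unfold u in *; lra.
- replace ((2 * PI - 0) * (eps / (2 * (2 * PI)))) with (eps / 2) by (field; lra). lra.
Qed.

(** * The maximum principle on rectangles *)

Definition contOn (D : C -> Prop) (g : C -> C) : Prop := forall z, D z -> contAt D g z.

Definition rect (a b c d : R) (z : C) : Prop := a <= fst z <= b /\ c <= snd z <= d.

Definition rect_bd (a b c d : R) (z : C) : Prop :=
  rect a b c d z /\ (fst z = a \/ fst z = b \/ snd z = c \/ snd z = d).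

Definition rect_int (a b c d : R) (z : C) : Prop := a < fst z < b /\ c < snd z < d.

Lemma contOn_subset (D E : C -> Prop) g :
  (forall w, E w -> D w) -> contOn D g -> contOn E g.
Proof. intros h hg z hz. apply contAt_subset with D; auto. Qed.

Lemma contAt_Cmod D g z : contAt D g z -> contAt D (fun w => RtoC (Cmod (g w))) z.
Proof.
intros hg eps he. destruct (hg eps he) as [d [hd h]]. exists d; split; auto.
intros w hw hwd. specialize (h w hw hwd). rewrite <- RtoC_minus, Cmod_R.
pose proof (Cmod_triangle_sub (g w) (g z)). pose proof (Cmod_triangle_sub (g z) (g w)).
rewrite Cmod_sub_sym in H0. apply Rabs_def1; lra.
Qed.

Definition clamp (a b x : R) : R := Rmax a (Rmin b x).

Lemma clamp_in a b x : a <= b -> a <= clamp a b x <= b.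
Proof.
intros h. unfold clamp. split; [apply Rmax_l|]. apply Rmax_lub; auto. apply Rmin_l.
Qed.

Lemma clamp_eq a b x : a <= x <= b -> clamp a b x = x.
Proof. intros h. unfold clamp. rewrite Rmin_right, Rmax_right; lra. Qed.

Lemma clamp_lip a b x y : Rabs (clamp a b x - clamp a b y) <= Rabs (x - y).
Proof.
unfold clamp, Rmax, Rmin, Rabs. repeat (destruct Rle_dec); repeat destruct Rcase_abs; lra.
Qed.

(** A 1-Lipschitz retraction in each coordinate. Composing with it turns continuity relative to the
    rectangle into continuity on the whole plane, the form that the two-variable continuity theorems
    expect. *)
Definition clampC (a b c d : R) (z : C) : C := (clamp a b (fst z), clamp c d (snd z)).

Lemma clampC_cont a b c d z : contAt full (clampC a b c d) z.
Proof.
intros eps he. exists (eps / 2); split; [lra|]. intros w _ hw.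
eapply Rle_lt_trans; [apply Cmod_le_Rabs|]. simpl.
pose proof (Rabs_fst_le_Cmod (w - z)%C) as h1. pose proof (Rabs_snd_le_Cmod (w - z)%C) as h2.
pose proof (clamp_lip a b (fst w) (fst z)). pose proof (clamp_lip c d (snd w) (snd z)).
simpl in h1, h2. unfold Rminus in *. lra.
Qed.

Lemma clampC_in a b c d z : a <= b -> c <= d -> rect a b c d (clampC a b c d z).
Proof. intros. split; apply clamp_in; auto. Qed.

Lemma clampC_eq a b c d z : rect a b c d z -> clampC a b c d z = z.
Proof. intros [h1 h2]. apply pair_eq; simpl; apply clamp_eq; auto. Qed.

Lemma contAt_clamp a b c d g z : a <= b -> c <= d -> contOn (rect a b c d) g ->
  contAt full (fun w => g (clampC a b c d w)) z.
Proof.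
intros hab hcd hg. apply (contAt_comp full (rect a b c d)).
- intros; apply clampC_in; auto.
- apply clampC_cont.
- apply hg, clampC_in; auto.
Qed.

Lemma rect_uniform a b c d g : contOn (rect a b c d) g ->
  forall eps, 0 < eps -> exists del, 0 < del /\ forall z w,
    rect a b c d z -> rect a b c d w -> Cmod (w - z)%C < del -> Cmod (g w - g z)%C < eps.
Proof.
intros hg eps he. destruct (Rle_dec a b) as [hab|hab].
2:{ exists 1; split; [lra|]. intros z w [h _]. lra. }
destruct (Rle_dec c d) as [hcd|hcd].
2:{ exists 1; split; [lra|]. intros z w [_ h]. lra. }
set (G := fun w => g (clampC a b c d w)).
assert (hG : forall x y, contAt full G (x, y)) by (intros; apply contAt_clamp; auto).
assert (he2 : 0 < eps / 2) by lra.
destruct (uniform_continuity_2d (fun x y => fst (G (x, y))) a b c d) with (mkposreal _ he2) as [d1 h1].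
{ intros x y _ _. apply contAt_2d, hG. }
destruct (uniform_continuity_2d (fun x y => snd (G (x, y))) a b c d) with (mkposreal _ he2) as [d2 h2].
{ intros x y _ _. apply contAt_2d, hG. }
exists (Rmin d1 d2). split; [apply Rmin_pos; apply cond_pos|].
intros z w hz hw hd. pose proof (Rmin_l d1 d2); pose proof (Rmin_r d1 d2).
pose proof (Rabs_fst_le_Cmod (w - z)%C) as k1. pose proof (Rabs_snd_le_Cmod (w - z)%C) as k2.
specialize (h1 (fst z) (snd z) (fst w) (snd w)). specialize (h2 (fst z) (snd z) (fst w) (snd w)).
destruct hz as [hz1 hz2]. destruct hw as [hw1 hw2]. simpl in h1, h2, k1, k2. unfold Rminus in h1, h2.
specialize (h1 ltac:(lra) ltac:(lra) ltac:(lra) ltac:(lra) ltac:(lra) ltac:(lra)).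
specialize (h2 ltac:(lra) ltac:(lra) ltac:(lra) ltac:(lra) ltac:(lra) ltac:(lra)).
rewrite <- !surjective_pairing in h1, h2. unfold G in h1, h2.
rewrite !clampC_eq in h1, h2 by (split; auto).
eapply Rle_lt_trans; [apply Cmod_le_Rabs|]. simpl. lra.
Qed.

(** Maximise over [y] for each [x], then over [x]. The chosen maximiser [m x] may jump, but the
    maximal value [F x (m x)] is continuous: by uniform continuity, comparing [m x] and [m u] on
    both vertical lines bounds the difference from either side. *)
Lemma rect_max a b c d (phi : C -> R) : a <= b -> c <= d ->
  contOn (rect a b c d) (fun z => RtoC (phi z)) ->
  exists z, rect a b c d z /\ forall w, rect a b c d w -> phi w <= phi z.
Proof.
intros hab hcd hphi.
set (F := fun x y => phi (clampC a b c d (x, y))).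
assert (hF : forall x y, continuity_2d_pt F x y).
{ intros x y. apply (contAt_2d (fun w => RtoC (phi (clampC a b c d w))) x y).
  apply (contAt_clamp a b c d (fun z => RtoC (phi z))); auto. }
assert (h1 : forall x, exists y, (forall v, c <= v <= d -> F x v <= F x y) /\ c <= y <= d).
{ intros x. apply continuity_ab_maj; auto. intros v _.
  apply (continuity_pt_2d_comp F (fun _ => x) (fun v => v)); auto; reg. }
pose (m := fun x => proj1_sig (constructive_indefinite_description _ (h1 x))).
assert (hm : forall x, (forall v, c <= v <= d -> F x v <= F x (m x)) /\ c <= m x <= d).
{ intros x. unfold m. destruct constructive_indefinite_description; auto. }
assert (hmc : forall x, continuity_pt (fun x => F x (m x)) x).
{ intros x. intros eps he.
  (* The strip of half-width 1 around [x] is only there to have a compact set containing the nearby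
     vertical lines; hence the [Rmin del 1]. *)
  destruct (uniform_continuity_2d F (x - 1) (x + 1) c d) with (mkposreal _ he) as [del hdel]; [intros; apply hF|].
  exists (Rmin del 1). split; [apply Rmin_pos; [apply cond_pos | lra]|].
  intros u [_ hu]. simpl in hu |- *. unfold R_dist in *.
  pose proof (Rmin_l del 1); pose proof (Rmin_r del 1).
  destruct (hm x) as [hx1 hx2], (hm u) as [hu1 hu2].
  assert (hux := hu). apply Rabs_def2 in hux.
  pose proof (cond_pos del).
  assert (k1 := hdel x (m x) u (m x) ltac:(lra) ltac:(lra) ltac:(lra) ltac:(lra) ltac:(lra)
     ltac:(rewrite Rminus_diag_eq, Rabs_R0 by auto; lra)).
  assert (k2 := hdel x (m u) u (m u) ltac:(lra) ltac:(lra) ltac:(lra) ltac:(lra) ltac:(lra)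
     ltac:(rewrite Rminus_diag_eq, Rabs_R0 by auto; lra)).
  simpl in k1, k2. apply Rabs_def2 in k1. apply Rabs_def2 in k2.
  specialize (hx1 (m u) hu2). specialize (hu1 (m x) hx2).
  apply Rabs_def1; lra. }
destruct (continuity_ab_maj (fun x => F x (m x)) a b hab) as [x [hx1 hx2]]; [intros; apply hmc|].
exists (x, m x). destruct (hm x) as [_ hmx]. split; [split; simpl; auto|].
intros w [hw1 hw2].
assert (e1 : phi w = F (fst w) (snd w)).
{ unfold F. rewrite <- surjective_pairing, clampC_eq; [|split]; auto. }
assert (e2 : phi (x, m x) = F x (m x)).
{ unfold F. rewrite clampC_eq; [|split]; auto. }
rewrite e1, e2. eapply Rle_trans; [apply (proj1 (hm (fst w))); auto | apply hx1; auto].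
Qed.

(** Each side is a degenerate rectangle, to which [rect_max] applies with [- phi]; the best of the
    four minimisers is kept. *)
Lemma rect_bd_min a b c d (phi : C -> R) : a <= b -> c <= d ->
  contOn (rect a b c d) (fun z => RtoC (phi z)) ->
  exists z, rect_bd a b c d z /\ forall w, rect_bd a b c d w -> phi z <= phi w.
Proof.
intros hab hcd hphi.
assert (hneg : contOn (rect a b c d) (fun z => RtoC (- phi z))).
{ intros z hz. apply contAt_ext with (fun w => 0 - RtoC (phi w))%C.
  - intros. rewrite RtoC_opp. ring.
  - rewrite RtoC_opp. ring.
  - apply contAt_minus; [apply contAt_const | auto]. }
destruct (rect_max a a c d (fun z => - phi z)) as [z1 [k1 h1]]; [lra|lra| |].
{ eapply contOn_subset; [|apply hneg]. unfold rect; intros; lra. }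
destruct (rect_max b b c d (fun z => - phi z)) as [z2 [k2 h2]]; [lra|lra| |].
{ eapply contOn_subset; [|apply hneg]. unfold rect; intros; lra. }
destruct (rect_max a b c c (fun z => - phi z)) as [z3 [k3 h3]]; [lra|lra| |].
{ eapply contOn_subset; [|apply hneg]. unfold rect; intros; lra. }
destruct (rect_max a b d d (fun z => - phi z)) as [z4 [k4 h4]]; [lra|lra| |].
{ eapply contOn_subset; [|apply hneg]. unfold rect; intros; lra. }
assert (hz : exists z, rect_bd a b c d z /\ phi z <= phi z1 /\ phi z <= phi z2 /\ phi z <= phi z3 /\ phi z <= phi z4).
{ assert (rect_bd a b c d z1 /\ rect_bd a b c d z2 /\ rect_bd a b c d z3 /\ rect_bd a b c d z4)
   as [g1 [g2 [g3 g4]]] by (unfold rect_bd, rect in *; repeat split; lra).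
  destruct (Rle_dec (phi z1) (phi z2)), (Rle_dec (phi z3) (phi z4));
  destruct (Rle_dec (phi z1) (phi z3)), (Rle_dec (phi z1) (phi z4)),
    (Rle_dec (phi z2) (phi z3)), (Rle_dec (phi z2) (phi z4));
  first [exists z1; (split; [assumption | lra]) | exists z2; (split; [assumption | lra])
       | exists z3; (split; [assumption | lra]) | exists z4; (split; [assumption | lra])]. }
destruct hz as [z [hz [g1 [g2 [g3 g4]]]]]. exists z; split; auto.
intros w [hw hb]. unfold rect in *.
destruct hb as [e|[e|[e|e]]].
- specialize (h1 w ltac:(lra)). lra.
- specialize (h2 w ltac:(lra)). lra.
- specialize (h3 w ltac:(lra)). lra.
- specialize (h4 w ltac:(lra)). lra.
Qed.

(** The interior hypothesis of the maximum principle, weak enough to hold for a slope function at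
    its own base point. *)
Definition punctured_hol (g : C -> C) (z : C) : Prop :=
  exists r, 0 < r /\ hol g (fun w => 0 < Cmod (w - z)%C < r).

(* An interior maximum [z0] of [|g|^2 + eps |z|^2] is impossible: by the AM-GM inequality the real part of
   [conj (g z0) * g z + eps * conj z0 * (z - z0)] is at most [|g z0|^2 - eps s^2 / 2] on the circle of radius [s]
   about [z0], whereas its mean over that circle is [|g z0|^2]. *)
Lemma max_principle a b c d g M : a <= b -> c <= d ->
  contOn (rect a b c d) g ->
  (forall z, rect_int a b c d z -> punctured_hol g z) ->
  (forall z, rect_bd a b c d z -> Cmod (g z) <= M) ->
  forall z, rect a b c d z -> Cmod (g z) <= M.
Proof.
intros hab hcd hc hg hM z1 hz1. apply Rnot_lt_le. intros hlt.
assert (hM0 : 0 <= M).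
{ eapply Rle_trans; [apply Cmod_ge_0 | apply (hM (a, c))]. unfold rect_bd, rect; simpl; lra. }
set (B := a ^ 2 + b ^ 2 + c ^ 2 + d ^ 2 + 1).
assert (hB : forall z, rect a b c d z -> Cmod z ^ 2 < B).
{ intros z [h1 h2]. rewrite Cmod_sqr. unfold B.
  assert (fst z ^ 2 <= a ^ 2 + b ^ 2) by (destruct (Rle_dec 0 (fst z)); nra).
  assert (snd z ^ 2 <= c ^ 2 + d ^ 2) by (destruct (Rle_dec 0 (snd z)); nra). lra. }
assert (hB0 : 0 < B) by (unfold B; nra).
set (D := Cmod (g z1) ^ 2 - M ^ 2). assert (hD : 0 < D) by (unfold D; nra).
(* The perturbation [eps * |z|^2] stays below half of the excess [D] of [|g z1|^2] over [M^2], so it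
   cannot move the maximum of [phi] to the boundary. *)
set (eps := D / (2 * B)). assert (he : 0 < eps) by (apply Rdiv_lt_0_compat; lra).
assert (heB : eps * B = D / 2) by (unfold eps; field; lra).
set (phi := fun z => Cmod (g z) ^ 2 + eps * Cmod z ^ 2).
destruct (rect_max a b c d phi) as [z0 [hz0 hmax]]; auto.
{ intros z hz. apply contAt_ext with (fun w => RtoC (Cmod (g w)) ^ 2 + RtoC eps * RtoC (Cmod w) ^ 2)%C.
  - intros w _. unfold phi. rewrite RtoC_plus, RtoC_mult, !RtoC_pow. reflexivity.
  - unfold phi. rewrite RtoC_plus, RtoC_mult, !RtoC_pow. reflexivity.
  - apply contAt_plus; [|apply contAt_mult; [apply contAt_const|]]; apply contAt_pow, contAt_Cmod; auto.
    apply contAt_id. }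
assert (hin : rect_int a b c d z0).
{ apply NNPP. intros hn.
  assert (hb : rect_bd a b c d z0) by (unfold rect_bd, rect_int, rect in *; split; [auto | lra]).
  specialize (hM z0 hb). specialize (hmax z1 hz1). unfold phi in hmax.
  specialize (hB z0 hz0). pose proof (Cmod_ge_0 (g z0)). pose proof (Cmod_ge_0 z1). unfold D in *.
  assert (Cmod (g z0) ^ 2 <= M ^ 2) by nra. assert (0 <= eps * Cmod z1 ^ 2) by nra.
  assert (eps * Cmod z0 ^ 2 <= eps * B) by nra. nra. }
destruct (hg z0 hin) as [r [hr hgr]].
destruct hin as [hi1 hi2].
set (s := Rmin (Rmin (fst z0 - a) (b - fst z0)) (Rmin (Rmin (snd z0 - c) (d - snd z0)) r) / 2).
assert (hs : 0 < s /\ s < fst z0 - a /\ s < b - fst z0 /\ s < snd z0 - c /\ s < d - snd z0 /\ s < r).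
{ unfold s.
  pose proof (Rmin_l (fst z0 - a) (b - fst z0)); pose proof (Rmin_r (fst z0 - a) (b - fst z0)).
  pose proof (Rmin_l (snd z0 - c) (d - snd z0)); pose proof (Rmin_r (snd z0 - c) (d - snd z0)).
  pose proof (Rmin_l (Rmin (snd z0 - c) (d - snd z0)) r);
  pose proof (Rmin_r (Rmin (snd z0 - c) (d - snd z0)) r).
  pose proof (Rmin_l (Rmin (fst z0 - a) (b - fst z0)) (Rmin (Rmin (snd z0 - c) (d - snd z0)) r));
  pose proof (Rmin_r (Rmin (fst z0 - a) (b - fst z0)) (Rmin (Rmin (snd z0 - c) (d - snd z0)) r)).
  assert (0 < Rmin (Rmin (fst z0 - a) (b - fst z0)) (Rmin (Rmin (snd z0 - c) (d - snd z0)) r)).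
  { repeat apply Rmin_pos; lra. }
  lra. }
destruct hs as [hs0 [hs1 [hs2 [hs3 [hs4 hs5]]]]].
assert (hcirc : forall t, rect a b c d (circ z0 s t)).
{ intros t. pose proof (circ_dist z0 s t ltac:(lra)) as e.
  pose proof (Rabs_fst_le_Cmod (circ z0 s t - z0)%C) as k1.
  pose proof (Rabs_snd_le_Cmod (circ z0 s t - z0)%C) as k2. rewrite e in k1, k2.
  apply Rabs_le_between in k1. apply Rabs_le_between in k2.
  unfold rect. simpl in *. lra. }
set (G := fun z => (Cconj (g z0) * g z + RtoC eps * Cconj z0 * (z - z0))%C).
assert (hmv : RInt (fun t => fst (G (circ z0 s t))) 0 (2 * PI) = 2 * PI * fst (G z0)).
{ apply mean_value with r; [| |lra].
  - apply contAt_plus; apply contAt_mult; try apply contAt_const.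
    + apply contAt_locally with (rect a b c d) s; auto.
      intros w hw. pose proof (Rabs_fst_le_Cmod (w - z0)%C) as k1.
      pose proof (Rabs_snd_le_Cmod (w - z0)%C) as k2.
      assert (k1' : Rabs (fst (w - z0)%C) < s) by lra. assert (k2' : Rabs (snd (w - z0)%C) < s) by lra.
      apply Rabs_def2 in k1'. apply Rabs_def2 in k2'.
      unfold rect. simpl in *. lra.
    + apply contAt_minus; [apply contAt_id | apply contAt_const].
  - apply hol_plus; apply hol_mult; auto using hol_const.
    apply hol_minus; [apply hol_id | apply hol_const]. }
assert (e0 : fst (G z0) = Cmod (g z0) ^ 2).
{ rewrite Cmod_sqr. unfold G. simpl. ring. }
assert (hle : forall t, fst (G (circ z0 s t)) <= Cmod (g z0) ^ 2 - eps * s ^ 2 / 2).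
{ intros t. specialize (hmax _ (hcirc t)). unfold phi in hmax.
  pose proof (circ_dist z0 s t ltac:(lra)) as e.
  assert (e2 : Cmod (circ z0 s t - z0)%C ^ 2 = s ^ 2) by (rewrite e; reflexivity).
  clearbody eps. clear - hmax e2 he. set (w := circ z0 s t) in *. clearbody w.
  rewrite !Cmod_sqr in hmax. rewrite !Cmod_sqr in e2. rewrite Cmod_sqr. unfold G.
  destruct (g z0) as [a1 a2], (g w) as [b1 b2], z0 as [x0 y0], w as [x y].
  simpl in *.
  set (q := (x + - x0) * x0 + (y + - y0) * y0).
  assert (e3 : x ^ 2 + y ^ 2 = x0 ^ 2 + y0 ^ 2 + 2 * q + s ^ 2) by (unfold q; lra).
  assert (h4 : b1 ^ 2 + b2 ^ 2 + eps * (2 * q + s ^ 2) <= a1 ^ 2 + a2 ^ 2).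
  { replace (2 * q + s ^ 2) with ((x ^ 2 + y ^ 2) - (x0 ^ 2 + y0 ^ 2)) by lra. lra. }
  pose proof (pow2_ge_0 (a1 - b1)); pose proof (pow2_ge_0 (a2 - b2)).
  match goal with |- ?L <= _ => replace L with (a1 * b1 + a2 * b2 + eps * q) by (unfold q; ring) end.
  lra. }
assert (hI : RInt (fun t => fst (G (circ z0 s t))) 0 (2 * PI) <= RInt (fun _ => Cmod (g z0) ^ 2 - eps * s ^ 2 / 2) 0 (2 * PI)).
{ pose proof PI_RGT_0. apply RInt_le; [lra| |apply ex_RInt_const|intros; apply hle].
  apply circ_ex_RInt. intros t.
  assert (hG : hol G (fun w => 0 < Cmod (w - z0)%C < r)).
  { apply hol_plus; apply hol_mult; auto using hol_const.
    apply hol_minus; [apply hol_id | apply hol_const]. }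
  apply (hol_cont _ _ _ hG). rewrite circ_dist; lra. }
rewrite hmv, e0, RInt_const in hI.
change (2 * PI * Cmod (g z0) ^ 2 <= (2 * PI - 0) * (Cmod (g z0) ^ 2 - eps * s ^ 2 / 2)) in hI.
pose proof PI_RGT_0. assert (0 < PI * (eps * s ^ 2)).
{ apply Rmult_lt_0_compat; [lra|]. apply Rmult_lt_0_compat; [lra|]. apply pow_lt; lra. }
lra.
Qed.

(** The version that reaches [f'] and [/ f']: uniform limits inherit the bound, although nothing is
    known about their own differentiability. *)
Lemma max_principle_lim a b c d g M : a <= b -> c <= d ->
  (forall eta, 0 < eta -> exists h, contOn (rect a b c d) h /\
    (forall z, rect_int a b c d z -> punctured_hol h z) /\
    (forall z, rect a b c d z -> Cmod (h z - g z)%C <= eta)) ->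
  (forall z, rect_bd a b c d z -> Cmod (g z) <= M) ->
  forall z, rect a b c d z -> Cmod (g z) <= M.
Proof.
intros hab hcd hlim hM z hz. apply le_epsilon. intros eps he.
destruct (hlim (eps / 2)) as [h [h1 [h2 h3]]]; [lra|].
assert (hh : Cmod (h z) <= M + eps / 2).
{ apply (max_principle a b c d h); auto. intros w hw. specialize (hM w hw).
  destruct hw as [hw _]. specialize (h3 w hw). pose proof (Cmod_triangle_sub (h w) (g w)). lra. }
specialize (h3 z hz). pose proof (Cmod_triangle_sub (g z) (h z)). rewrite Cmod_sub_sym in h3. lra.
Qed.

Lemma hol_punctured g P z : Copen P -> P z -> hol g P -> punctured_hol g z.
Proof.
intros ho hz hg. destruct (ho z hz) as [r [hr h]]. exists r; split; auto.
apply hol_subset with P; auto. intros w hw. apply h; lra.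
Qed.

(** * Schwarz lemma and injective functions on squares *)

(** Squares of half-side [r] play the role of discs, to match the maximum principle on rectangles.
    Their boundary points lie at distance between [r] and [2 * r] from [a], so this costs only
    constant factors. *)
Definition sq (a : C) (r : R) : C -> Prop := rect (fst a - r) (fst a + r) (snd a - r) (snd a + r).
Definition sq_bd (a : C) (r : R) : C -> Prop := rect_bd (fst a - r) (fst a + r) (snd a - r) (snd a + r).
Definition osq (a : C) (r : R) : C -> Prop := rect_int (fst a - r) (fst a + r) (snd a - r) (snd a + r).

Lemma osq_Copen a r : Copen (osq a r).
Proof.
intros z [h1 h2].
set (d := Rmin (Rmin (fst z - (fst a - r)) (fst a + r - fst z)) (Rmin (snd z - (snd a - r)) (snd a + r - snd z))).
exists d. split.
- repeat apply Rmin_pos; lra.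
- intros w hw. pose proof (Rabs_fst_le_Cmod (w - z)%C) as k1.
  pose proof (Rabs_snd_le_Cmod (w - z)%C) as k2.
  pose proof (Rmin_l (fst z - (fst a - r)) (fst a + r - fst z)).
  pose proof (Rmin_r (fst z - (fst a - r)) (fst a + r - fst z)).
  pose proof (Rmin_l (snd z - (snd a - r)) (snd a + r - snd z)).
  pose proof (Rmin_r (snd z - (snd a - r)) (snd a + r - snd z)).
  pose proof (Rmin_l (Rmin (fst z - (fst a - r)) (fst a + r - fst z)) (Rmin (snd z - (snd a - r)) (snd a + r - snd z))).
  pose proof (Rmin_r (Rmin (fst z - (fst a - r)) (fst a + r - fst z)) (Rmin (snd z - (snd a - r)) (snd a + r - snd z))).
  fold d in H3, H4.
  assert (k1' : Rabs (fst (w - z)%C) < d) by lra. assert (k2' : Rabs (snd (w - z)%C) < d) by lra.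
  apply Rabs_def2 in k1'. apply Rabs_def2 in k2'. simpl in k1', k2'.
  unfold osq, rect_int. lra.
Qed.

Lemma sq_osq a r r' z : r < r' -> sq a r z -> osq a r' z.
Proof. intros h [h1 h2]. unfold osq, rect_int. lra. Qed.

Lemma osq_sq a r z : osq a r z -> sq a r z.
Proof. intros [h1 h2]. unfold sq, rect. lra. Qed.

Lemma sq_center a r : 0 <= r -> sq a r a.
Proof. intros h. unfold sq, rect. lra. Qed.

Lemma sq_of_dist a r z : Cmod (z - a)%C <= r -> sq a r z.
Proof.
intros h. pose proof (Rabs_fst_le_Cmod (z - a)%C) as k1. pose proof (Rabs_snd_le_Cmod (z - a)%C) as k2.
assert (k1' : Rabs (fst (z - a)%C) <= r) by lra. assert (k2' : Rabs (snd (z - a)%C) <= r) by lra.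
apply Rabs_le_between in k1'. apply Rabs_le_between in k2'. simpl in *. unfold sq, rect. lra.
Qed.

Lemma sq_dist a r z : sq a r z -> Cmod (z - a)%C <= 2 * r.
Proof.
intros [h1 h2]. eapply Rle_trans; [apply Cmod_le_Rabs|]. simpl.
assert (Rabs (fst z + - fst a) <= r) by (apply Rabs_le; lra).
assert (Rabs (snd z + - snd a) <= r) by (apply Rabs_le; lra). lra.
Qed.

Lemma sq_bd_dist a r z : 0 <= r -> sq_bd a r z -> r <= Cmod (z - a)%C.
Proof.
intros hr [_ h]. pose proof (Rabs_fst_le_Cmod (z - a)%C) as k1. pose proof (Rabs_snd_le_Cmod (z - a)%C) as k2.
simpl in k1, k2. destruct h as [e|[e|[e|e]]]; rewrite e in *.
- replace (fst a - r + - fst a) with (- r) in k1 by ring. rewrite Rabs_Ropp, Rabs_pos_eq in k1; auto.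
- replace (fst a + r + - fst a) with r in k1 by ring. rewrite Rabs_pos_eq in k1; auto.
- replace (snd a - r + - snd a) with (- r) in k2 by ring. rewrite Rabs_Ropp, Rabs_pos_eq in k2; auto.
- replace (snd a + r + - snd a) with r in k2 by ring. rewrite Rabs_pos_eq in k2; auto.
Qed.

Lemma Copen_neq_0 g U : Copen U -> hol g U -> Copen (fun z => U z /\ g z <> RtoC 0).
Proof.
intros ho hg z [hz h0]. destruct (ho z hz) as [r [hr h]].
destruct (contAt_away_from_0 full g z (hol_cont _ _ _ hg hz) h0) as [d [hd h']].
exists (Rmin r d). split; [apply Rmin_pos; auto|]. intros w hw.
pose proof (Rmin_l r d); pose proof (Rmin_r r d). split; [apply h; lra|].
apply Cmod_gt_0. specialize (h' w I ltac:(lra)). pose proof (Cmod_ge_0 (g z)). lra.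
Qed.

Lemma dq_punctured f L b U z : Copen U -> hol f U -> U z -> punctured_hol (dq f L b) z.
Proof.
intros ho hf hz. pose proof (dq_hol f L b U ho hf) as hd.
destruct (classic (z = b)) as [->|hne].
- destruct (ho b hz) as [r [hr h]]. exists r; split; auto.
  eapply hol_subset; [|apply hd]. intros w [hw1 hw2]. split; auto.
  intros ->. rewrite Cmod_sub_self in hw1. lra.
- apply hol_punctured with (fun z => U z /\ z <> b); auto. apply Copen_punctured; auto.
Qed.

Lemma punctured_hol_inv g U z : Copen U -> U z -> (forall w, U w -> g w <> RtoC 0) ->
  punctured_hol g z -> punctured_hol (fun w => / g w)%C z.
Proof.
intros ho hz h0 [r [hr hg]]. destruct (ho z hz) as [r' [hr' h]].
exists (Rmin r r'). split; [apply Rmin_pos; auto|].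
pose proof (Rmin_l r r'); pose proof (Rmin_r r r').
apply hol_inv.
- eapply hol_subset; [|apply hg]. intros w hw. simpl in *. lra.
- intros w hw. apply h0, h. lra.
Qed.

(** The maximum principle for the slope at [a]: on the boundary the denominator has modulus at least
    [r]. The value of the slope at [a] itself then gives the Cauchy estimate [schwarz_deriv]. *)
Lemma schwarz U g L a r M : Copen U -> hol g U -> (forall z, sq a r z -> U z) -> 0 < r ->
  is_cderiv g a L -> (forall z, sq_bd a r z -> Cmod (g z - g a)%C <= M) ->
  forall z, sq a r z -> Cmod (dq g L a z) <= M / r.
Proof.
intros ho hg hU hr hL hM. apply max_principle; try lra.
- intros z hz. apply contAt_full, dq_cont with U; auto.
- intros z hz. apply dq_punctured with U; auto. apply hU, osq_sq, hz.
- intros z hz. pose proof (sq_bd_dist a r z ltac:(lra) hz) as hd.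
  specialize (hM z hz). rewrite (dq_mult g L a z), Cmod_mult in hM.
  apply Rmult_le_reg_r with r; auto. unfold Rdiv. rewrite Rmult_assoc, Rinv_l by lra.
  pose proof (Cmod_ge_0 (dq g L a z)). nra.
Qed.

Lemma schwarz_deriv U g L a r M : Copen U -> hol g U -> (forall z, sq a r z -> U z) -> 0 < r ->
  is_cderiv g a L -> (forall z, sq_bd a r z -> Cmod (g z - g a)%C <= M) -> Cmod L <= M / r.
Proof.
intros ho hg hU hr hL hM. rewrite <- (dq_at g L a). apply schwarz with U; auto.
apply sq_center; lra.
Qed.

Definition inj_on (f : C -> C) (U : C -> Prop) : Prop :=
  forall z w, U z -> U w -> f z = f w -> z = w.

Lemma dq_neq_0 f L b U w : inj_on f U -> L <> RtoC 0 -> U b -> U w -> dq f L b w <> RtoC 0.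
Proof.
intros hi hL hb hw. unfold dq. destruct excluded_middle_informative as [|hne]; auto.
unfold Cdiv. apply Cmult_neq_0.
- apply Csub_neq_0. intros e. apply hne, hi; auto.
- apply Cmod_gt_0. rewrite Cmod_inv by (apply Csub_neq_0; auto).
  apply Rinv_0_lt_compat, Cmod_gt_0, Csub_neq_0; auto.
Qed.

(* Injectivity makes the slope function nowhere zero, so that its reciprocal obeys the maximum principle. *)
Lemma dq_lower f U L b p q s t k : Copen U -> hol f U -> inj_on f U -> p <= q -> s <= t ->
  (forall z, rect p q s t z -> U z) -> rect p q s t b -> is_cderiv f b L -> L <> RtoC 0 -> 0 < k ->
  (forall z, rect_bd p q s t z -> k <= Cmod (dq f L b z)) -> k <= Cmod L.
Proof.
intros ho hf hi hpq hst hU hb hL hL0 hk hbd.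
assert (h0 : forall w, U w -> dq f L b w <> RtoC 0) by (intros; apply dq_neq_0 with U; auto).
assert (h : Cmod (/ dq f L b b)%C <= / k).
{ apply (max_principle p q s t (fun w => / dq f L b w)%C); auto.
  - intros z hz. apply contAt_Cinv; [|apply h0; auto]. apply contAt_full, dq_cont with U; auto.
  - intros z hz. assert (hz' : U z) by (apply hU; unfold rect, rect_int in *; lra).
    apply punctured_hol_inv with U; auto. apply dq_punctured with U; auto.
  - intros z hz. rewrite Cmod_inv by (apply h0, hU, hz). apply Rinv_le_contravar; auto. }
rewrite dq_at, Cmod_inv in h by auto. apply Cmod_gt_0 in hL0.
apply Rinv_le_contravar in h; [|apply Rinv_0_lt_compat; auto]. rewrite !Rinv_inv in h. auto.
Qed.

Lemma deriv_0_segment (g : C -> C) (x1 x2 y : R) : x1 < x2 ->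
  (forall x, x1 <= x <= x2 -> is_cderiv g (x, y) (RtoC 0)) -> g (x1, y) = g (x2, y).
Proof.
intros hx h.
assert (hd : forall x, x1 <= x <= x2 -> is_derive (fun s => fst (g (s, y))) x 0 /\ is_derive (fun s => snd (g (s, y))) x 0).
{ intros x hx'. destruct (cderiv_curve g (fun s => s) (fun _ => y) x 1 0 (RtoC 0)) as [h1 h2]; auto.
  - auto_derive; auto.
  - auto_derive; auto.
  - simpl in h1, h2. split; [replace 0 with (0 * 1 - 0 * 0) at 1 by ring | replace 0 with (0 * 1 + 0 * 0) at 1 by ring]; auto. }
apply pair_eq.
- apply (eq_is_derive (fun s => fst (g (s, y)))); auto. intros t ht. apply hd, ht.
- apply (eq_is_derive (fun s => snd (g (s, y)))); auto. intros t ht. apply hd, ht.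
Qed.

(** Suppose [f' a = 0]. At a nearby [b] with [f' b <> 0], [dq_lower] bounds [|f' b|] below by a
    constant independent of [b], whereas continuity of [f'] makes [f' b] small. Hence [f'] vanishes
    on a whole neighbourhood of [a], so [f] is constant on a segment, against injectivity. *)
Lemma inj_deriv_neq_0 (f f' : C -> C) U a : Copen U ->
  (forall z, U z -> is_cderiv f z (f' z) /\ contAt full f' z) -> inj_on f U -> U a -> f' a <> RtoC 0.
Proof.
intros ho hf hi ha h0.
assert (hh : hol f U) by (exists f'; auto).
assert (hcf : forall z, U z -> contAt full f z) by (intros; apply hol_cont with U; auto).
destruct (ho a ha) as [rho [hrho hball]].
set (r := rho / 3).
assert (hU : forall z, sq a r z -> U z).
{ intros z hz. apply hball. apply sq_dist in hz. unfold r in hz. lra. }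
assert (hr : 0 < r) by (unfold r; lra).
destruct (rect_bd_min (fst a - r) (fst a + r) (snd a - r) (snd a + r) (fun z => Cmod (f z - f a)%C))
  as [z0 [hz0 hmin]]; try lra.
{ intros z hz. apply (contAt_Cmod _ (fun w => f w - f a)%C).
  apply contAt_full, contAt_minus; [apply hcf, hU, hz | apply contAt_const]. }
set (m := Cmod (f z0 - f a)%C) in *.
assert (hm : 0 < m).
{ apply Cmod_gt_0, Csub_neq_0. intros e. apply hi in e; [|apply hU, hz0 | auto].
  pose proof (sq_bd_dist a r z0 ltac:(lra) hz0) as hd. rewrite e, Cmod_sub_self in hd. lra. }
destruct (hcf a ha (m / 2)) as [d1 [hd1 h1]]; [lra|].
destruct (proj2 (hf a ha) (m / (8 * r))) as [d2 [hd2 h2]]; [apply Rdiv_lt_0_compat; lra|].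
set (d := Rmin (Rmin d1 d2) r).
assert (hd : 0 < d <= d1 /\ d <= d2 /\ d <= r).
{ unfold d. pose proof (Rmin_l (Rmin d1 d2) r); pose proof (Rmin_r (Rmin d1 d2) r).
  pose proof (Rmin_l d1 d2); pose proof (Rmin_r d1 d2).
  assert (0 < Rmin (Rmin d1 d2) r) by (repeat apply Rmin_pos; lra). lra. }
assert (hzero : forall b, Cmod (b - a)%C < d -> f' b = RtoC 0).
{ intros b hb. apply NNPP. intros hb0.
  specialize (h1 b I ltac:(lra)). specialize (h2 b I ltac:(lra)).
  rewrite h0 in h2. replace (f' b - RtoC 0)%C with (f' b) in h2 by ring.
  assert (hsb : sq a r b) by (apply sq_of_dist; lra).
  (* On the boundary [|f z - f b| >= m / 2] and [|z - b| <= 3 * r], so the slope has modulus at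
     least [m / (6 * r)]. *)
  assert (hlow : m / (8 * r) <= Cmod (f' b)).
  { apply (dq_lower f U (f' b) b (fst a - r) (fst a + r) (snd a - r) (snd a + r)); auto; try lra.
    - apply hf, hU, hsb.
    - apply Rdiv_lt_0_compat; lra.
    - intros z hz. specialize (hmin z hz).
      assert (hzs : sq a r z) by apply hz.
      assert (hfz : m / 2 <= Cmod (f z - f b)%C).
      { pose proof (Cmod_sub_triangle (f z) (f b) (f a)). lra. }
      assert (hdz : Cmod (z - b)%C <= 3 * r).
      { pose proof (Cmod_sub_triangle z a b). apply sq_dist in hzs. rewrite (Cmod_sub_sym a b) in H. lra. }
      rewrite (dq_mult f (f' b) b z), Cmod_mult in hfz.
      pose proof (Cmod_ge_0 (dq f (f' b) b z)). pose proof (Cmod_ge_0 (z - b)%C).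
      assert (m / 2 <= Cmod (dq f (f' b) b z) * (3 * r)) by nra.
      apply Rmult_le_reg_r with (8 * r); [lra|]. unfold Rdiv. rewrite Rmult_assoc, Rinv_l by lra. nra. }
  lra. }
assert (heq : f (fst a, snd a) = f (fst a + d / 2, snd a)).
{ apply deriv_0_segment; [lra|]. intros x hx.
  assert (hb : Cmod ((x, snd a) - a)%C < d).
  { eapply Rle_lt_trans; [apply Cmod_le_Rabs|]. simpl.
    rewrite (Rplus_opp_r (snd a)), Rabs_R0, Rabs_pos_eq; lra. }
  rewrite <- (hzero _ hb). apply hf, hU, sq_of_dist. lra. }
apply hi in heq.
- injection heq. lra.
- apply hU, (sq_center a r). lra.
- apply hU. unfold sq, rect. simpl. lra.
Qed.

(* If [w] were omitted, the maximum principle for [1 / (f - w)] would be violated at [a]. *)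
Lemma open_mapping f U a r m w : Copen U -> hol f U -> (forall z, sq a r z -> U z) -> 0 <= r ->
  (forall z, sq_bd a r z -> m <= Cmod (f z - f a)%C) -> Cmod (w - f a)%C < m / 2 ->
  exists z, sq a r z /\ f z = w.
Proof.
intros ho hf hU hr hm hw. apply NNPP. intros hn.
assert (hne : forall z, sq a r z -> (f z - w)%C <> RtoC 0).
{ intros z hz. apply Csub_neq_0. intros e. apply hn. exists z; auto. }
pose proof (Cmod_ge_0 (w - f a)%C).
assert (h : Cmod (/ (f a - w))%C <= / (m - Cmod (w - f a)%C)).
{ apply (max_principle (fst a - r) (fst a + r) (snd a - r) (snd a + r) (fun z => / (f z - w))%C); try lra.
  - intros z hz. apply contAt_Cinv; [|apply hne; auto].
    apply contAt_full, contAt_minus; [apply hol_cont with U; auto | apply contAt_const].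
  - intros z hz. apply hol_punctured with (fun z => U z /\ (f z - w)%C <> RtoC 0).
    + apply Copen_neq_0; auto. apply hol_minus; auto. apply hol_const.
    + split; [apply hU, osq_sq, hz | apply hne, osq_sq, hz].
    + apply hol_inv; [|tauto]. apply hol_minus; [|apply hol_const].
      eapply hol_subset; [|apply hf]. tauto.
  - intros z hz. rewrite Cmod_inv by (apply hne, hz). apply Rinv_le_contravar; [lra|].
    specialize (hm z hz). pose proof (Cmod_sub_triangle (f z) w (f a)). lra.
  - apply sq_center; auto. }
assert (h0 : (f a - w)%C <> RtoC 0) by (apply hne, sq_center; auto).
rewrite Cmod_inv in h by auto. apply Cmod_gt_0 in h0.
apply Rinv_le_contravar in h; [|apply Rinv_0_lt_compat; auto]. rewrite !Rinv_inv in h.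
rewrite (Cmod_sub_sym (f a) w) in h. lra.
Qed.

(** * Holomorphic square roots *)

Lemma Csqrt_exists (w : C) : exists s : C, (s * s)%C = w.
Proof.
destruct w as [x y]. set (n := Cmod (x, y)).
assert (hn : n ^ 2 = x ^ 2 + y ^ 2) by apply Cmod_sqr.
assert (hn0 : 0 <= n) by apply Cmod_ge_0.
assert (h1 : 0 <= (n + x) / 2) by nra. assert (h2 : 0 <= (n - x) / 2) by nra.
assert (hp : sqrt ((n + x) / 2) * sqrt ((n - x) / 2) = Rabs y / 2).
{ rewrite <- sqrt_mult by auto. replace ((n + x) / 2 * ((n - x) / 2)) with (Rsqr (y / 2)).
  - rewrite sqrt_Rsqr_abs. unfold Rdiv. rewrite Rabs_mult, (Rabs_pos_eq (/ 2)); lra.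
  - unfold Rsqr. lra. }
pose proof (sqrt_sqrt _ h1) as e1. pose proof (sqrt_sqrt _ h2) as e2.
destruct (Rle_dec 0 y) as [hy|hy].
- exists (sqrt ((n + x) / 2), sqrt ((n - x) / 2)). rewrite Rabs_pos_eq in hp by auto.
  apply pair_eq; simpl; lra.
- exists (sqrt ((n + x) / 2), - sqrt ((n - x) / 2)). rewrite Rabs_left in hp by lra.
  apply pair_eq; simpl; lra.
Qed.

Definition Cexp (x y : R) : C := (exp x * cos y, exp x * sin y).

Definition ray (a z : C) (t : R) : C := (fst a + t * fst (z - a)%C, snd a + t * snd (z - a)%C).

(** For [t = 1], the real part of the integral of [k] along the segment from [a] to [z]. *)
Definition ray_int (k : C -> C) (a z : C) (t : R) : R :=
  RInt (fun s => fst ((z - a) * k (ray a z s))%C) 0 t.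

Lemma ray_integrand_continuity (k : C -> C) a z t : contAt full k (ray a z t) ->
  continuity_pt (fun s => fst ((z - a) * k (ray a z s))%C) t.
Proof.
intros hk.
assert (h : contAt full (fun w => (z - a) * k w)%C (ray a z t)).
{ apply contAt_mult; auto. apply contAt_const. }
apply contAt_2d in h. destruct h as [h _].
apply (continuity_pt_2d_comp (fun u v => fst ((z - a) * k (u, v))%C)
  (fun s => fst a + s * fst (z - a)%C) (fun s => snd a + s * snd (z - a)%C)); auto; reg.
Qed.

Lemma ray_integrable (k : C -> C) a z s t : (forall w, contAt full k w) ->
  ex_RInt (fun s => fst ((z - a) * k (ray a z s))%C) s t.
Proof.
intros hk. apply (ex_RInt_continuous (V := R_CompleteNormedModule)). intros u _.
apply continuity_pt_filterlim, ray_integrand_continuity, hk.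
Qed.

Lemma ray_int_derive (k : C -> C) a z t : (forall w, contAt full k w) ->
  is_derive (ray_int k a z) t (fst ((z - a) * k (ray a z t))%C).
Proof.
intros hk. apply (is_derive_RInt (V := R_CompleteNormedModule) (fun s => fst ((z - a) * k (ray a z s))%C) _ 0).
- apply filter_forall. intros u. apply (RInt_correct (V := R_CompleteNormedModule)), ray_integrable, hk.
- apply continuity_pt_filterlim, ray_integrand_continuity, hk.
Qed.

Lemma ray_sq a z r t : sq a r z -> 0 <= t <= 1 -> sq a r (ray a z t).
Proof.
intros [h1 h2] ht. unfold sq, rect, ray. simpl. nra.
Qed.

Lemma ray_osq a z r t : osq a r z -> 0 <= t <= 1 -> osq a r (ray a z t).
Proof.
intros [h1 h2] ht. unfold osq, rect_int, ray. simpl. nra.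
Qed.

Lemma ray_sub_le a z w t : 0 <= t <= 1 -> Cmod (ray a w t - ray a z t)%C <= Cmod (w - z)%C.
Proof.
intros ht. replace (ray a w t - ray a z t)%C with (RtoC t * (w - z))%C.
- rewrite Cmod_mult, Cmod_R, Rabs_pos_eq by lra. pose proof (Cmod_ge_0 (w - z)%C). nra.
- apply pair_eq; simpl; ring.
Qed.

(** The two integrands differ by [(w - z) * k] on the new segment plus [(z - a)] times a variation
    of [k]; the first is small since [k] is bounded on a square, the second since it is uniformly
    continuous there. *)
Lemma ray_int_cont (k : C -> C) a z : (forall w, contAt full k w) ->
  contAt full (fun z => RtoC (ray_int k a z 1)) z.
Proof.
intros hk. set (r := Cmod (z - a)%C + 1). pose proof (Cmod_ge_0 (z - a)%C) as hr0.
destruct (rect_max (fst a - r) (fst a + r) (snd a - r) (snd a + r) (fun w => Cmod (k w))) as [w0 [_ hmax]];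
  try (unfold r; lra).
{ intros w _. apply contAt_Cmod, contAt_full, hk. }
set (K := Cmod (k w0)) in *. assert (hK : 0 <= K) by apply Cmod_ge_0.
intros eps he.
destruct (rect_uniform (fst a - r) (fst a + r) (snd a - r) (snd a + r) k) with (eps / (4 * r))
  as [d [hd hu]].
{ intros w _. apply contAt_full, hk. }
{ apply Rdiv_lt_0_compat; unfold r; lra. }
set (e := Rmin (Rmin 1 d) (eps / (4 * (K + 1)))).
assert (he' : 0 < e) by (repeat apply Rmin_pos; try lra; apply Rdiv_lt_0_compat; lra).
assert (hes : e <= 1 /\ e <= d /\ e <= eps / (4 * (K + 1))).
{ unfold e. pose proof (Rmin_l (Rmin 1 d) (eps / (4 * (K + 1)))); pose proof (Rmin_r (Rmin 1 d) (eps / (4 * (K + 1)))).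
  pose proof (Rmin_l 1 d); pose proof (Rmin_r 1 d). lra. }
destruct hes as [he1 [he2 he3]].
exists e; split; auto. intros w _ hw.
rewrite <- RtoC_minus, Cmod_R. unfold ray_int.
assert (i1 := ray_integrable k a w 0 1 hk). assert (i2 := ray_integrable k a z 0 1 hk).
assert (ei := RInt_minus (V := R_CompleteNormedModule) _ _ _ _ i1 i2).
change (RInt (fun s => fst ((w - a) * k (ray a w s))%C - fst ((z - a) * k (ray a z s))%C) 0 1 =
  RInt (fun s => fst ((w - a) * k (ray a w s))%C) 0 1 - RInt (fun s => fst ((z - a) * k (ray a z s))%C) 0 1) in ei.
rewrite <- ei.
eapply Rle_lt_trans; [apply abs_RInt_le_const with (M := eps / 2)|]; try lra.
- apply (ex_RInt_minus (V := R_NormedModule) _ _ _ _ i1 i2).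
- intros t ht.
  assert (hsz : sq a r z) by (apply sq_of_dist; unfold r; lra).
  assert (hsw : sq a r w).
  { apply sq_of_dist. pose proof (Cmod_sub_triangle w z a). unfold r; lra. }
  pose proof (ray_sq a z r t hsz ht) as rz. pose proof (ray_sq a w r t hsw ht) as rw.
  pose proof (ray_sub_le a z w t ht) as rd.
  specialize (hu _ _ rz rw ltac:(lra)). specialize (hmax _ rw).
  replace (fst ((w - a) * k (ray a w t))%C - fst ((z - a) * k (ray a z t))%C)
    with (fst ((w - z) * k (ray a w t) + (z - a) * (k (ray a w t) - k (ray a z t)))%C)
    by (simpl; ring).
  eapply Rle_trans; [apply Rabs_fst_le_Cmod|]. eapply Rle_trans; [apply Cmod_triangle|].
  rewrite !Cmod_mult.
  assert (Cmod (w - z)%C * Cmod (k (ray a w t)) <= eps / 4).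
  { apply Rle_trans with (eps / (4 * (K + 1)) * (K + 1)).
    - apply Rmult_le_compat; try apply Cmod_ge_0; lra.
    - right. field. lra. }
  assert (Cmod (z - a)%C * Cmod (k (ray a w t) - k (ray a z t))%C <= eps / 4).
  { apply Rle_trans with (r * (eps / (4 * r))).
    - apply Rmult_le_compat; try apply Cmod_ge_0; unfold r in *; lra.
    - right. field. unfold r; lra. }
  lra.
Qed.

(** In complex terms: if [(u + iv)' = (p + iq)(u + iv)] and [(A + iB)' = p + iq], then
    [(u + iv) * exp (- A - iB)] has derivative 0. The two conclusions are its real and imaginary
    parts. *)
Lemma polar_ode_constant (u v A B : R -> R) t p q :
  is_derive u t (p * u t - q * v t) -> is_derive v t (p * v t + q * u t) ->
  is_derive A t p -> is_derive B t q ->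
  is_derive (fun t => exp (- A t) * (u t * cos (B t) + v t * sin (B t))) t 0 /\
  is_derive (fun t => exp (- A t) * (v t * cos (B t) - u t * sin (B t))) t 0.
Proof.
intros hu hv hA hB.
assert (eu := is_derive_unique _ _ _ hu). assert (ev := is_derive_unique _ _ _ hv).
assert (eA := is_derive_unique _ _ _ hA). assert (eB := is_derive_unique _ _ _ hB).
change (Derive (fun x => u x) t = p * u t - q * v t) in eu.
change (Derive (fun x => v x) t = p * v t + q * u t) in ev.
change (Derive (fun x => A x) t = p) in eA. change (Derive (fun x => B x) t = q) in eB.
split; auto_derive; repeat split; try (eexists; eassumption);
  rewrite eu, ev, eA, eB; ring.
Qed.

(** The logarithmic derivative [g' / g] is integrated only along segments issuing from [a], and
    solving the differential equation on each segment yields [g z = g a * exp (al z + i be z)]; path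
    independence never enters. Halving the exponent gives a continuous [h] with [h * h = g], and
    such an [h] is automatically holomorphic. *)
Lemma hol_sqrt g a r r' : r < r' -> 0 < r -> hol g (osq a r') -> (forall z, osq a r' z -> g z <> RtoC 0) ->
  exists h, hol h (osq a r) /\ forall z, osq a r z -> (h z * h z)%C = g z.
Proof.
intros hrr hr [g' hg] h0.
set (k := fun w => (g' w / g w)%C).
(* Clamping to the closed square makes the integrand continuous on the whole plane; the margin
   between [r] and [r'] keeps that closed square inside the domain of [g]. *)
set (kc := fun w => k (clampC (fst a - r) (fst a + r) (snd a - r) (snd a + r) w)).
assert (hkc : forall w, contAt full kc w).
{ intros w. apply contAt_clamp; try lra. intros z hz. apply contAt_full.
  assert (hz' : osq a r' z) by (apply sq_osq with r; auto).
  apply contAt_mult; [apply hg; auto|]. apply contAt_Cinv; [eapply cderiv_cont, hg; auto | auto]. }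
assert (hkce : forall w, sq a r w -> kc w = k w) by (intros; unfold kc; rewrite clampC_eq; auto).
(* Multiplication by [- Ci] turns the imaginary part into the real part, so [be] is the imaginary
   part of the integral whose real part is [al]. *)
set (kd := fun w => (- Ci * kc w)%C).
assert (hkd : forall w, contAt full kd w) by (intros; apply contAt_mult; [apply contAt_const | auto]).
set (al := fun z => ray_int kc a z 1). set (be := fun z => ray_int kd a z 1).
assert (hpolar : forall z, osq a r z -> g z = (g a * Cexp (al z) (be z))%C).
{ intros z hz.
  pose (u := fun t => fst (g (ray a z t))). pose (v := fun t => snd (g (ray a z t))).
  assert (hN : forall t, 0 <= t <= 1 ->
    is_derive (fun t => exp (- ray_int kc a z t) * (u t * cos (ray_int kd a z t) + v t * sin (ray_int kd a z t))) t 0 /\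
    is_derive (fun t => exp (- ray_int kc a z t) * (v t * cos (ray_int kd a z t) - u t * sin (ray_int kd a z t))) t 0).
  { intros t ht.
    assert (hray : osq a r (ray a z t)) by (apply ray_osq; auto).
    assert (hray' : osq a r' (ray a z t)) by (eapply sq_osq; [apply hrr | apply osq_sq; auto]).
    set (p := fst ((z - a) * kc (ray a z t))%C). set (q := snd ((z - a) * kc (ray a z t))%C).
    assert (hgk : (g' (ray a z t) * (z - a))%C = ((p, q) * g (ray a z t))%C).
    { replace (p, q) with ((z - a) * kc (ray a z t))%C by apply surjective_pairing.
      rewrite hkce by (apply osq_sq; auto). unfold k. field. apply h0; auto. }
    destruct (cderiv_curve g (fun t => fst a + t * fst (z - a)%C) (fun t => snd a + t * snd (z - a)%C) t
       (fst (z - a)%C) (snd (z - a)%C) (g' (ray a z t))) as [d1 d2].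
    { auto_derive; auto. simpl. ring. }
    { auto_derive; auto. simpl. ring. }
    { apply hg; auto. }
    apply polar_ode_constant with p q.
    - replace (p * u t - q * v t) with (fst (g' (ray a z t)) * fst (z - a)%C - snd (g' (ray a z t)) * snd (z - a)%C); auto.
      apply (f_equal fst) in hgk. unfold u, v. simpl in hgk |- *. exact hgk.
    - replace (p * v t + q * u t) with (snd (g' (ray a z t)) * fst (z - a)%C + fst (g' (ray a z t)) * snd (z - a)%C); auto.
      apply (f_equal snd) in hgk. unfold u, v. simpl in hgk |- *. lra.
    - apply ray_int_derive; auto.
    - replace q with (fst ((z - a) * kd (ray a z t))%C); [apply ray_int_derive; auto|].
      unfold q, kd. simpl. ring. }
  assert (e1 := eq_is_derive _ 0 1 (fun t ht => proj1 (hN t ht)) Rlt_0_1).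
  assert (e2 := eq_is_derive _ 0 1 (fun t ht => proj2 (hN t ht)) Rlt_0_1).
  cbv beta in e1, e2.
  assert (ez : forall k', ray_int k' a z 0 = 0).
  { intros k'. unfold ray_int. rewrite RInt_point. reflexivity. }
  assert (r0 : ray a z 0 = a) by (apply pair_eq; simpl; ring).
  assert (r1 : ray a z 1 = z) by (apply pair_eq; simpl; ring).
  unfold u, v in e1, e2. rewrite !ez, r0, r1, cos_0, sin_0, Ropp_0, exp_0 in e1, e2.
  fold (al z) in e1, e2. fold (be z) in e1, e2. rewrite exp_Ropp in e1, e2.
  pose proof (exp_pos (al z)) as hE. set (E := exp (al z)) in *.
  pose proof (sin2_cos2 (be z)) as hsc. unfold Rsqr in hsc.
  set (c := cos (be z)) in *. set (s := sin (be z)) in *.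
  set (gu := fst (g z)) in *. set (gv := snd (g z)) in *.
  assert (f1 : fst (g a) = / E * (gu * c + gv * s)) by lra.
  assert (f2 : snd (g a) = / E * (gv * c - gu * s)) by lra.
  apply pair_eq; unfold Cexp; simpl; fold gu gv E c s; rewrite f1, f2.
  - transitivity (gu * (s * s + c * c)); [rewrite hsc; ring | field; lra].
  - transitivity (gv * (s * s + c * c)); [rewrite hsc; ring | field; lra]. }
destruct (Csqrt_exists (g a)) as [s0 hs0].
set (h := fun z => (s0 * Cexp (al z / 2) (be z / 2))%C).
assert (hh : forall z, osq a r z -> (h z * h z)%C = g z).
{ intros z hz. rewrite (hpolar z hz), <- hs0. unfold h, Cexp.
  set (x := al z). set (y := be z).
  replace (exp x) with (exp (x / 2) * exp (x / 2)) by (rewrite <- exp_plus; f_equal; field).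
  replace (cos y) with (cos (y / 2) * cos (y / 2) - sin (y / 2) * sin (y / 2))
    by (rewrite <- cos_plus; f_equal; field).
  replace (sin y) with (sin (y / 2) * cos (y / 2) + cos (y / 2) * sin (y / 2))
    by (rewrite <- sin_plus; f_equal; field).
  apply pair_eq; simpl; ring. }
assert (hcont : forall z, contAt full h z).
{ intros z. apply contAt_mult; [apply contAt_const|].
  assert (ca : contAt full (fun z => RtoC (al z)) z) by (apply ray_int_cont; auto).
  assert (cb : contAt full (fun z => RtoC (be z)) z) by (apply ray_int_cont; auto).
  destruct z as [x y]. apply contAt_2d in ca. apply contAt_2d in cb.
  destruct ca as [ca _], cb as [cb _]. simpl in ca, cb.
  assert (ce : continuity_2d_pt (fun u v => exp (al (u, v) / 2)) x y).
  { apply (continuity_1d_2d_pt_comp (fun x => exp (x / 2)) (fun u v => al (u, v))); auto. reg. }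
  apply contAt_2d; unfold Cexp; simpl; split; apply continuity_2d_pt_mult; auto.
  - apply (continuity_1d_2d_pt_comp (fun x => cos (x / 2)) (fun u v => be (u, v))); auto. reg.
  - apply (continuity_1d_2d_pt_comp (fun x => sin (x / 2)) (fun u v => be (u, v))); auto. reg. }
exists h. split; auto.
assert (hne : forall z, osq a r z -> h z <> RtoC 0).
{ intros z hz e. apply (h0 z); [eapply sq_osq; [apply hrr | apply osq_sq; auto]|].
  rewrite <- hh, e by auto. ring. }
(* From [g w - g z = (h w - h z) * (h w + h z)], where the second factor stays away from 0 near [z],
   the slope of [h] is the slope of [g] divided by a continuous nonzero function. *)
exists (fun z => g' z / (h z + h z))%C. intros z hz.
assert (hz' : osq a r' z) by (eapply sq_osq; [apply hrr | apply osq_sq; auto]).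
destruct (hg z hz') as [hgd hgc].
assert (h2 : (h z + h z)%C <> RtoC 0).
{ replace (h z + h z)%C with (RtoC 2 * h z)%C by ring. apply Cmult_neq_0; auto.
  intros e. apply RtoC_inj in e. lra. }
split.
- destruct (osq_Copen a r z hz) as [d1 [hd1 b1]].
  assert (hsum : contAt full (fun w => h w + h z)%C z) by (apply contAt_plus; auto; apply contAt_const).
  destruct (contAt_away_from_0 full _ z hsum h2) as [d2 [hd2 b2]].
  rewrite <- (dq_at g (g' z) z) at 1.
  apply (cderiv_intro h z (fun w => dq g (g' z) z w / (h w + h z))%C (Rmin d1 d2)).
  + apply Rmin_pos; auto.
  + apply contAt_mult; [apply cderiv_dq; auto | apply contAt_Cinv; auto].
  + intros w hw _. pose proof (Rmin_l d1 d2); pose proof (Rmin_r d1 d2).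
    assert (hn : (h w + h z)%C <> RtoC 0).
    { apply Cmod_gt_0. eapply Rle_lt_trans; [|apply b2; [exact I | lra]].
      pose proof (Cmod_ge_0 (h z + h z)%C). lra. }
    replace (dq g (g' z) z w / (h w + h z) * (w - z))%C
      with ((dq g (g' z) z w * (w - z)) / (h w + h z))%C by (field; auto).
    rewrite <- dq_mult, <- (hh z), <- (hh w) by (auto; apply b1; lra). field. auto.
- apply contAt_mult; auto. apply contAt_Cinv; auto. apply contAt_plus; auto.
Qed.

(** * Koebe distortion and growth *)

(* With [w0 = f z1] omitted and [h = sqrt (f - w0)], the image of [h] contains a disc about [h a] of radius comparable
   to [|h a|]; as [h] never takes the value [- h z], the reciprocal of [h + h a] is bounded and Schwarz applies. *)
Lemma koebe_omitted f a r r' z1 delta : 0 < r -> r < r' -> hol f (osq a r') -> inj_on f (osq a r') ->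
  (forall z, osq a r' z -> f z <> f z1) -> (forall z, sq_bd a r z -> delta <= Cmod (f z - f a)%C) ->
  Cmod (f a - f z1)%C <= 5 / 4 * delta ->
  forall z, Cmod (z - a)%C <= r / 48 -> Cmod (f z - f a)%C <= 30 * delta.
Proof.
intros hr hrr hf hi homit hdel hd.
set (d := Cmod (f a - f z1)%C) in *.
set (r1 := (r + r') / 2).
destruct (hol_sqrt (fun z => f z - f z1)%C a r1 r') as [h [hh hsq]]; try (unfold r1; lra).
{ apply hol_minus; auto. apply hol_const. }
{ intros z hz. apply Csub_neq_0, homit, hz. }
assert (hsub : forall z, osq a r1 z -> osq a r' z).
{ intros z hz. apply (sq_osq a r1); [unfold r1; lra | apply osq_sq, hz]. }
assert (hsub2 : forall z, sq a r z -> osq a r1 z).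
{ intros z hz. apply (sq_osq a r); [unfold r1; lra | auto]. }
assert (ha : osq a r1 a) by (apply hsub2, sq_center; lra).
set (n := Cmod (h a)).
assert (hn : n * n = d) by (unfold n, d; rewrite <- Cmod_mult, hsq; auto).
assert (hn0 : 0 < n).
{ apply Cmod_gt_0. intros e. apply (homit a); [apply hsub, ha|].
  pose proof (hsq a ha) as e1. rewrite e in e1.
  apply NNPP. intros hne. apply Csub_neq_0 in hne. apply hne. rewrite <- e1. ring. }
assert (hdiff : forall z, osq a r1 z -> (f z - f a = (h z - h a) * (h z + h a))%C).
{ intros z hz. replace (f z - f a)%C with ((f z - f z1) - (f a - f z1))%C by ring.
  rewrite <- !hsq by auto. ring. }
(* Otherwise [|h z + h a| <= 7/3 * n], and the product is less than [7/9 * n^2 <= 7/9 * 5/4 * delta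
   = 35/36 * delta]; this is what the bound [5/4] on the omitted value is for. *)
assert (hbd : forall z, sq_bd a r z -> n / 3 <= Cmod (h z - h a)%C).
{ intros z hz. apply Rnot_lt_le. intros hlt. specialize (hdel z hz).
  assert (hz' : osq a r1 z) by apply hsub2, hz.
  rewrite hdiff, Cmod_mult in hdel by auto.
  assert (Cmod (h z + h a)%C <= 7 / 3 * n).
  { replace (h z + h a)%C with ((h z - h a) + RtoC 2 * h a)%C by ring.
    eapply Rle_trans; [apply Cmod_triangle|]. rewrite Cmod_mult, Cmod_R, Rabs_pos_eq by lra. fold n. lra. }
  pose proof (Cmod_ge_0 (h z - h a)%C). pose proof (Cmod_ge_0 (h z + h a)%C).
  assert (Cmod (h z - h a)%C * Cmod (h z + h a)%C <= n / 3 * (7 / 3 * n)) by (apply Rmult_le_compat; lra).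
  nra. }
(* Here [n / 6] is half of [n / 3], the radius provided by [open_mapping]. A point [z'] with
   [h z' = - h z] has [f z' = f z], so [z' = z] and [h z = 0], which means that the omitted value is
   taken. *)
assert (hsum : forall z, sq a r z -> n / 6 <= Cmod (h z + h a)%C).
{ intros z hz. apply Rnot_lt_le. intros hlt.
  destruct (open_mapping h (osq a r1) a r (n / 3) (- h z)%C) as [z' [hz' e]]; auto; try lra.
  - apply osq_Copen.
  - replace (- h z - h a)%C with (- (h z + h a))%C by ring. rewrite Cmod_opp. lra.
  - assert (e2 : f z' = f z).
    { apply NNPP. intros hne. apply Csub_neq_0 in hne. apply hne.
      replace (f z' - f z)%C with ((f z' - f z1) - (f z - f z1))%C by ring.
      rewrite <- !hsq, e by auto. ring. }
    apply hi in e2; [|auto|auto]. subst z'.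
    apply (homit z); [auto|]. apply NNPP. intros hne. apply Csub_neq_0 in hne. apply hne.
    rewrite <- hsq by auto.
    assert (e3 : h z = RtoC 0).
    { pose proof (f_equal fst e) as e3. pose proof (f_equal snd e) as e4. simpl in e3, e4.
      apply pair_eq; simpl; lra. }
    rewrite e3. ring. }
set (U := fun z => osq a r1 z /\ (h z + h a)%C <> RtoC 0).
assert (hhs : hol (fun z => h z + h a)%C (osq a r1)) by (apply hol_plus; auto; apply hol_const).
assert (hU : Copen U) by (apply Copen_neq_0; auto; apply osq_Copen).
assert (hUs : forall z, sq a r z -> U z).
{ intros z hz. split; auto. apply Cmod_gt_0. specialize (hsum z hz). lra. }
set (q := fun z => (/ (h z + h a))%C).
assert (hq : hol q U).
{ apply hol_inv; [|unfold U; tauto]. eapply hol_subset; [|apply hhs]. unfold U; tauto. }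
assert (hqb : forall z, sq a r z -> Cmod (q z) <= 6 / n).
{ intros z hz. unfold q. rewrite Cmod_inv by apply hUs, hz.
  replace (6 / n) with (/ (n / 6)) by (field; lra). apply Rinv_le_contravar; auto. lra. }
intros z hz.
assert (hzs : sq a r z) by (apply sq_of_dist; lra).
assert (has : sq a r a) by (apply sq_center; lra).
destruct hq as [q' hq'].
assert (hs : Cmod (dq q (q' a) a z) <= 12 / n / r).
{ apply (schwarz U); auto.
  - exists q'; auto.
  - apply hq', hUs, has.
  - intros w hw. pose proof (hqb w (proj1 hw)) as b1. pose proof (hqb a has) as b2.
    unfold Cminus. eapply Rle_trans; [apply Cmod_triangle|]. rewrite Cmod_opp. lra. }
(* The radius [r / 48] is chosen so that [q] moves by at most [/ (4 * n)], half of
   [|q a| = / (2 * n)]. *)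
assert (hqz : Cmod (q z - q a)%C <= / (4 * n)).
{ rewrite (dq_mult q (q' a) a z), Cmod_mult.
  replace (/ (4 * n)) with (12 / n / r * (r / 48)) by (field; lra).
  apply Rmult_le_compat; auto; apply Cmod_ge_0. }
assert (hqa : Cmod (q a) = / (2 * n)).
{ unfold q. rewrite Cmod_inv by apply hUs, has. f_equal.
  replace (h a + h a)%C with (RtoC 2 * h a)%C by ring. rewrite Cmod_mult, Cmod_R, Rabs_pos_eq; fold n; lra. }
assert (hqz2 : / (4 * n) <= Cmod (q z)).
{ pose proof (Cmod_triangle_sub (q a) (q z)) as t. rewrite Cmod_sub_sym, hqa in t.
  replace (/ (2 * n)) with (/ (4 * n) + / (4 * n)) in t by (field; lra). lra. }
assert (hb : Cmod (h z + h a)%C <= 4 * n).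
{ unfold q in hqz2. rewrite Cmod_inv in hqz2 by apply hUs, hzs.
  apply Rinv_le_contravar in hqz2; [|apply Rinv_0_lt_compat; lra].
  rewrite !Rinv_inv in hqz2. auto. }
rewrite hdiff, Cmod_mult by auto.
assert (hb2 : Cmod (h z - h a)%C <= 6 * n).
{ replace (h z - h a)%C with ((h z + h a) + - (RtoC 2 * h a))%C by ring.
  eapply Rle_trans; [apply Cmod_triangle|].
  rewrite Cmod_opp, Cmod_mult, Cmod_R, (Rabs_pos_eq 2) by lra. fold n. lra. }
(* Here [24 * n^2 = 24 * d <= 24 * 5/4 * delta], whence the factor 30. *)
apply Rle_trans with (6 * n * (4 * n)); [|nra].
apply Rmult_le_compat; auto; apply Cmod_ge_0.
Qed.

(** The omitted value is manufactured: [delta] is attained at a boundary point [z0], and [z1] lies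
    slightly farther out on the line from [a] through [z0]. By injectivity [f z1] is omitted on a
    square that still contains [sq a r], and by continuity it is at distance at most [5/4 * delta]
    from [f a]. *)
Lemma koebe_growth f a r rho : 0 < r -> r < rho -> hol f (osq a rho) -> inj_on f (osq a rho) ->
  exists delta, 0 < delta /\ (forall z, sq_bd a r z -> delta <= Cmod (f z - f a)%C) /\
    forall z, Cmod (z - a)%C <= r / 48 -> Cmod (f z - f a)%C <= 30 * delta.
Proof.
intros hr hrr hf hi.
assert (hsub : forall z, sq a r z -> osq a rho z) by (intros; apply sq_osq with r; auto).
assert (ha : osq a rho a) by (apply hsub, sq_center; lra).
destruct (rect_bd_min (fst a - r) (fst a + r) (snd a - r) (snd a + r) (fun z => Cmod (f z - f a)%C))
  as [z0 [hz0 hmin]]; try lra.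
{ intros z hz. apply (contAt_Cmod _ (fun w => f w - f a)%C).
  apply contAt_full, contAt_minus; [apply (hol_cont _ _ _ hf), hsub, hz | apply contAt_const]. }
set (delta := Cmod (f z0 - f a)%C) in *.
assert (hz0s : sq a r z0) by apply hz0.
assert (hdel : 0 < delta).
{ apply Cmod_gt_0, Csub_neq_0. intros e. apply hi in e; auto.
  pose proof (sq_bd_dist a r z0 ltac:(lra) hz0) as hd. rewrite e, Cmod_sub_self in hd. lra. }
exists delta. split; auto. split; auto.
destruct (hol_cont _ _ _ hf (hsub _ hz0s) (delta / 4)) as [d [hd hc]]; [lra|].
(* The first term keeps [|z1 - z0| <= 2 * t * r] below [d]; the second keeps [z1] inside the square
   of half-side [rho]. *)
set (t := Rmin (d / (4 * r)) ((rho - r) / (2 * r))).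
assert (ht : 0 < t) by (apply Rmin_pos; apply Rdiv_lt_0_compat; lra).
assert (ht1 : t * r <= d / 4).
{ apply Rle_trans with (d / (4 * r) * r); [apply Rmult_le_compat_r; [lra | apply Rmin_l]|].
  right; field; lra. }
assert (ht2 : t * r <= (rho - r) / 2).
{ apply Rle_trans with ((rho - r) / (2 * r) * r); [apply Rmult_le_compat_r; [lra | apply Rmin_r]|].
  right; field; lra. }
set (z1 := (z0 + RtoC t * (z0 - a))%C).
assert (htr : 0 < t * r) by (apply Rmult_lt_0_compat; lra).
assert (hz1 : osq a rho z1).
{ destruct hz0s as [h1 h2]. unfold osq, rect_int, z1. simpl. nra. }
assert (hz1n : ~ osq a (r + t * r) z1).
{ destruct hz0 as [_ hb]. unfold osq, rect_int, z1. simpl.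
  intros [k1 k2]. destruct hb as [e|[e|[e|e]]]; rewrite e in *; nra. }
assert (hsub' : forall z, osq a (r + t * r) z -> osq a rho z).
{ intros z hz. apply sq_osq with (r + t * r); [lra | apply osq_sq, hz]. }
apply (koebe_omitted f a r (r + t * r) z1); auto; try lra.
- eapply hol_subset; [|apply hf]. auto.
- intros z w hz hw. apply hi; auto.
- intros z hz e. apply hi in e; auto. subst z. auto.
- pose proof (Cmod_sub_triangle (f a) (f z0) (f z1)) as h.
  rewrite (Cmod_sub_sym (f a) (f z0)), (Cmod_sub_sym (f z0) (f z1)) in h. fold delta in h.
  specialize (hc z1 I). assert (Cmod (z1 - z0)%C < d).
  { unfold z1. replace (z0 + RtoC t * (z0 - a) - z0)%C with (RtoC t * (z0 - a))%C by ring.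
    rewrite Cmod_mult, Cmod_R, Rabs_pos_eq by lra. apply sq_dist in hz0s. nra. }
  specialize (hc H). lra.
Qed.

(** Both derivatives are compared with the same [delta]: nonvanishing slopes give
    [|f' a| >= delta / (2 * r)], and the Cauchy estimate on the square of half-side [r / 192] about
    [b], which lies within [r / 48] of [a], gives [|f' b| <= 60 * delta / (r / 192)]. The factor is
    [60 * 192 * 2 = 23040]. *)
Lemma koebe_distortion (f f' : C -> C) a r rho b : 0 < r -> r < rho ->
  (forall z, osq a rho z -> is_cderiv f z (f' z) /\ contAt full f' z) -> inj_on f (osq a rho) ->
  Cmod (b - a)%C <= r / 192 -> Cmod (f' b) <= 23040 * Cmod (f' a).
Proof.
intros hr hrr hf hi hb.
assert (hh : hol f (osq a rho)) by (exists f'; auto).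
assert (hsub : forall z, sq a r z -> osq a rho z) by (intros; apply sq_osq with r; auto).
assert (ha : osq a rho a) by (apply hsub, sq_center; lra).
destruct (koebe_growth f a r rho) as [delta [hd [hbd hgr]]]; auto.
assert (hlow : delta / (2 * r) <= Cmod (f' a)).
{ apply (dq_lower f (osq a rho) (f' a) a (fst a - r) (fst a + r) (snd a - r) (snd a + r)); auto; try lra.
  - apply osq_Copen.
  - apply sq_center; lra.
  - apply hf, ha.
  - apply inj_deriv_neq_0 with f (osq a rho); auto. apply osq_Copen.
  - apply Rdiv_lt_0_compat; lra.
  - intros z hz. specialize (hbd z hz). rewrite (dq_mult f (f' a) a z), Cmod_mult in hbd.
    pose proof (sq_dist a r z (proj1 hz)). pose proof (Cmod_ge_0 (dq f (f' a) a z)).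
    apply Rmult_le_reg_r with (2 * r); [lra|]. unfold Rdiv. rewrite Rmult_assoc, Rinv_l by lra. nra. }
assert (hlow' : delta <= 2 * r * Cmod (f' a)).
{ apply Rmult_le_reg_r with (/ (2 * r)); [apply Rinv_0_lt_compat; lra|].
  replace (2 * r * Cmod (f' a) * / (2 * r)) with (Cmod (f' a)) by (field; lra). exact hlow. }
assert (hsb : forall z, sq b (r / 192) z -> Cmod (z - a)%C <= r / 48).
{ intros z hz. apply sq_dist in hz. pose proof (Cmod_sub_triangle z b a). lra. }
assert (hbc : Cmod (f' b) <= 60 * delta / (r / 192)).
{ apply (schwarz_deriv (osq a rho) f (f' b) b (r / 192)); auto; try lra.
  - apply osq_Copen.
  - intros z hz. apply hsub, sq_of_dist. specialize (hsb z hz). lra.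
  - apply hf, hsub, sq_of_dist. lra.
  - intros z hz. pose proof (hgr z (hsb z (proj1 hz))).
    assert (Cmod (f b - f a)%C <= 30 * delta) by (apply hgr; lra).
    pose proof (Cmod_sub_triangle (f z) (f a) (f b)) as t.
    rewrite (Cmod_sub_sym (f a) (f b)) in t. lra. }
apply Rle_trans with (1 := hbc).
apply Rmult_le_reg_r with (r / 192); [lra|].
replace (60 * delta / (r / 192) * (r / 192)) with (60 * delta) by (field; lra). nra.
Qed.

(** Heights are climbed in steps of ratio [1 + kappa]. A step costs a factor [K <= (1 + kappa) ^ p],
    that is, at most the [p]-th power of its own ratio, so full steps multiply to a power of the
    total ratio; the leading [K] pays for one incomplete step. *)
Lemma iter_up_down (F : R -> R) (K kappa : R) (p : nat) : 1 <= K -> 0 < kappa -> K <= (1 + kappa) ^ p ->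
  (forall y, 0 < y -> 0 <= F y) ->
  (forall y y', 0 < y -> 0 < y' -> Rabs (y' - y) <= kappa * y -> F y' <= K * F y) ->
  forall n y y', 0 < y -> y <= y' <= (1 + kappa) ^ n * y ->
    F y' <= K * (y' / y) ^ p * F y /\ F y <= K * (y' / y) ^ p * F y'.
Proof.
intros hK hk hKp hF0 hF.
assert (hone : forall y y', 0 < y -> y <= y' -> 1 <= (y' / y) ^ p).
{ intros y y' hy hyy. rewrite <- (pow1 p). apply pow_incr. split; [lra|].
  apply Rmult_le_reg_r with y; auto. unfold Rdiv. rewrite Rmult_assoc, Rinv_l; lra. }
assert (hstep : forall y y', 0 < y -> y <= y' <= (1 + kappa) * y -> F y' <= K * F y /\ F y <= K * F y').
{ intros y y' hy hyy. split; apply hF; try lra.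
  - rewrite Rabs_pos_eq; lra.
  - rewrite Rabs_left1 by lra. nra. }
assert (hbase : forall y y', 0 < y -> y <= y' <= (1 + kappa) * y ->
  F y' <= K * (y' / y) ^ p * F y /\ F y <= K * (y' / y) ^ p * F y').
{ intros y y' hy hyy. destruct (hstep y y' hy hyy) as [h1 h2]. pose proof (hone y y' hy (proj1 hyy)).
  pose proof (hF0 y hy). pose proof (hF0 y' ltac:(lra)).
  assert (0 <= K * F y) by nra. assert (0 <= K * F y') by nra. split; nra. }
induction n as [|n IH]; intros y y' hy hyy.
- apply hbase; auto. simpl in hyy. nra.
- destruct (Rle_dec y' ((1 + kappa) * y)) as [h|h]; [apply hbase; auto; lra|].
  set (z := y' / (1 + kappa)).
  assert (ez : y' = (1 + kappa) * z) by (unfold z; field; lra).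
  assert (hz : y <= z) by nra.
  assert (hz2 : z <= (1 + kappa) ^ n * y) by (simpl in hyy; nra).
  destruct (IH y z hy ltac:(lra)) as [i1 i2].
  destruct (hstep z y') as [s1 s2]; [lra | nra |].
  assert (e : (y' / y) ^ p = (1 + kappa) ^ p * (z / y) ^ p).
  { rewrite <- Rpow_mult_distr. f_equal. rewrite ez. field. lra. }
  rewrite e. pose proof (hone y z hy hz) as h1.
  set (P := (z / y) ^ p) in *. set (Q := (1 + kappa) ^ p) in *.
  pose proof (hF0 y hy). pose proof (hF0 y' ltac:(lra)). pose proof (hF0 z ltac:(lra)).
  assert (hKP : 0 <= K * P) by nra.
  split.
  + apply Rle_trans with (K * (K * P * F y)); [nra|].
    replace (K * (K * P * F y)) with (K * (K * P) * F y) by ring.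
    apply Rmult_le_compat_r; auto. nra.
  + apply Rle_trans with (K * P * (K * F y')); [nra|].
    replace (K * P * (K * F y')) with (K * (K * P) * F y') by ring.
    apply Rmult_le_compat_r; auto. nra.
Qed.

Lemma pow_unbounded (q : R) : 0 < q -> forall M, exists n, M <= (1 + q) ^ n.
Proof.
intros hq M. destruct (Pow_x_infinity (1 + q)) with M as [n hn]; [rewrite Rabs_pos_eq; lra|].
exists n. specialize (hn n (Nat.le_refl n)). rewrite Rabs_pos_eq in hn; [lra|].
apply pow_le; lra.
Qed.

(** Go from [(0, 1)] up to [(0, Y)], across to [(x, Y)], then down to [(x, y)]. The vertical legs
    cost [K * Y ^ p] and [K * (Y / y) ^ p]; at height [Y] the horizontal steps have length
    [kappa * Y], so their number is bounded independently of [Y]. *)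
Lemma harnack_growth (F : C -> R) (K kappa : R) : 1 <= K -> 0 < kappa ->
  (forall z, inH z -> 0 <= F z) ->
  (forall z w, inH z -> inH w -> Cmod (w - z)%C <= kappa * snd z -> F w <= K * F z) ->
  exists (A : R) (p : nat), 0 <= A /\ forall x y Y : R, 0 < y <= Y -> 1 <= Y -> Rabs x <= Y ->
    y ^ p * F (x, y) <= A * Y ^ (2 * p).
Proof.
intros hK hk hF0 hF.
destruct (pow_unbounded kappa hk K) as [p hp].
assert (hdist : forall x y y', Cmod ((x, y') - (x, y))%C = Rabs (y' - y)).
{ intros. replace ((x, y') - (x, y))%C with (RtoC (y' - y) * Ci)%C by (apply pair_eq; simpl; ring).
  rewrite Cmod_mult, Cmod_Ci, Cmod_R. ring. }
assert (hvert : forall x y y', 0 < y -> y <= y' ->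
   F (x, y') <= K * (y' / y) ^ p * F (x, y) /\ F (x, y) <= K * (y' / y) ^ p * F (x, y')).
{ intros x y y' hy hyy. destruct (pow_unbounded kappa hk (y' / y)) as [n hn].
  apply (iter_up_down (fun y => F (x, y)) K kappa p) with n; auto.
  - intros v v' hv hv' hd. apply hF; auto. rewrite hdist. exact hd.
  - split; auto. apply Rmult_le_reg_r with (/ y); [apply Rinv_0_lt_compat; auto|].
    replace ((1 + kappa) ^ n * y * / y) with ((1 + kappa) ^ n) by (field; lra). exact hn. }
assert (hhor : forall Y, 0 < Y -> forall (j : nat) x, Rabs x <= INR j * (kappa * Y) -> F (x, Y) <= K ^ j * F (0, Y)).
{ intros Y hY. induction j as [|j IH]; intros x hx.
  - simpl in hx. assert (x = 0) by (apply Rabs_eq_0; pose proof (Rabs_pos x); lra). subst x. simpl. lra.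
  - destruct (Rle_dec (Rabs x) (kappa * Y)) as [hs|hs].
    + assert (h1 : F (x, Y) <= K * F (0, Y)).
      { apply hF; auto. replace ((x, Y) - (0, Y))%C with (RtoC x) by (apply pair_eq; simpl; ring).
        rewrite Cmod_R. auto. }
      apply Rle_trans with (1 := h1). apply Rmult_le_compat_r; [apply hF0; auto|].
      simpl. pose proof (pow_R1_Rle K j hK). nra.
    + assert (hx' : exists x', Rabs x' <= INR j * (kappa * Y) /\ Rabs (x - x') <= kappa * Y).
      { rewrite S_INR in hx. assert (0 <= kappa * Y) by nra.
        destruct (Rle_dec 0 x) as [h0|h0].
        - exists (x - kappa * Y). rewrite (Rabs_pos_eq x) in * by lra. split; rewrite Rabs_pos_eq; lra.
        - exists (x + kappa * Y). rewrite (Rabs_left x) in * by lra. split; rewrite Rabs_left1; lra. }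
      destruct hx' as [x' [k1 k2]]. specialize (IH x' k1).
      assert (h1 : F (x, Y) <= K * F (x', Y)).
      { apply hF; auto. replace ((x, Y) - (x', Y))%C with (RtoC (x - x')) by (apply pair_eq; simpl; ring).
        rewrite Cmod_R. auto. }
      simpl. nra. }
(* With [n * kappa > 1], [n] horizontal steps cover every [|x| <= Y]. *)
destruct (INR_unbounded (/ kappa)) as [n hn].
set (A := K * (K ^ n * (K * F (0, 1)))).
assert (hKn : 1 <= K ^ n) by (apply pow_R1_Rle; auto).
assert (hF1 : 0 <= F (0, 1)) by (apply hF0; unfold inH, Im; simpl; lra).
assert (hA0 : 0 <= K * F (0, 1)) by nra.
assert (hA1 : 0 <= K ^ n * (K * F (0, 1))) by nra.
exists A, p. split; [unfold A; nra|].
intros x y Y hy hY hx.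
destruct (hvert 0 1 Y) as [v1 _]; try lra. rewrite Rdiv_1_r in v1.
destruct (hvert x y Y) as [_ v2]; try lra.
assert (hh := hhor Y ltac:(lra) n x).
assert (hxn : Rabs x <= INR n * (kappa * Y)).
{ apply Rle_trans with (1 := hx). assert (/ kappa * kappa = 1) by (field; lra).
  assert (1 <= INR n * kappa) by nra. nra. }
specialize (hh hxn).
assert (hYp : 0 <= Y ^ p) by (apply pow_le; lra).
assert (hyp : 0 < y ^ p) by (apply pow_lt; lra).
assert (e : y ^ p * (Y / y) ^ p = Y ^ p) by (rewrite <- Rpow_mult_distr; f_equal; field; lra).
replace (2 * p)%nat with (p + p)%nat by lia. rewrite pow_add.
apply Rle_trans with (y ^ p * (K * (Y / y) ^ p * F (x, Y))); [nra|].
replace (y ^ p * (K * (Y / y) ^ p * F (x, Y))) with (K * Y ^ p * F (x, Y)) by (rewrite <- e; ring).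
apply Rle_trans with (K * Y ^ p * (K ^ n * (K * Y ^ p * F (0, 1)))).
- apply Rmult_le_compat_l; [nra|]. apply Rle_trans with (1 := hh). apply Rmult_le_compat_l; lra.
- unfold A. right. ring.
Qed.

(** * Phragmen-Lindelof *)

Lemma inH_Copen : Copen inH.
Proof.
intros z hz. exists (snd z). split; auto. intros w hw.
pose proof (Rabs_snd_le_Cmod (w - z)%C) as h. assert (h' : Rabs (snd (w - z)%C) < snd z) by lra.
apply Rabs_def2 in h'. simpl in h'. unfold inH, Im. lra.
Qed.

(* The factor [z^2 - r^2] vanishes at the two lower corners of the rectangle [[-r, r] x [0, r]], which compensates the
   blow-up of the growth bound near the real axis. *)
Definition damp (r eps : R) (z : C) : C := ((z * z - RtoC (r * r)) / (RtoC (r * r) * (1 - Ci * RtoC eps * z)))%C.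

(** The real part is [1 + eps * Im z], so there is no pole in the closed half-plane. The purpose of
    this denominator is decay: its modulus is of order [eps * r] on the far sides of the
    rectangle. *)
Lemma damp_den_re (eps : R) (z : C) : 0 < eps -> 0 <= snd z ->
  1 <= Cmod (1 - Ci * RtoC eps * z)%C.
Proof.
intros he hz. pose proof (Rabs_fst_le_Cmod (1 - Ci * RtoC eps * z)%C) as h. simpl in h.
assert (0 <= eps * snd z) by nra.
match type of h with Rabs ?e <= _ => replace e with (1 + eps * snd z) in h by ring end.
rewrite Rabs_pos_eq in h; lra.
Qed.

Lemma damp_den_neq_0 (r eps : R) (z : C) : 0 < r -> 0 < eps -> 0 <= snd z ->
  (RtoC (r * r) * (1 - Ci * RtoC eps * z))%C <> RtoC 0.
Proof.
intros hr he hz. apply Cmult_neq_0.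
- intros e. apply RtoC_inj in e. nra.
- apply Cmod_gt_0. pose proof (damp_den_re eps z he hz). lra.
Qed.

Lemma damp_Cmod (r eps : R) (z : C) : 0 < r -> 0 < eps -> 0 <= snd z ->
  Cmod (damp r eps z) * (r * r * Cmod (1 - Ci * RtoC eps * z)%C) = Cmod (z * z - RtoC (r * r))%C.
Proof.
intros hr he hz. pose proof (damp_den_neq_0 r eps z hr he hz) as h0.
unfold damp. rewrite Cmod_div, Cmod_mult, Cmod_R, Rabs_pos_eq by (auto; nra).
field. pose proof (damp_den_re eps z he hz). split; lra.
Qed.

Lemma damp_cont D r eps z : 0 < r -> 0 < eps -> 0 <= snd z -> contAt D (damp r eps) z.
Proof.
intros hr he hz. apply contAt_mult.
- apply contAt_minus; [apply contAt_mult; apply contAt_id | apply contAt_const].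
- apply contAt_Cinv; [|apply damp_den_neq_0; auto].
  apply contAt_mult; [apply contAt_const|]. apply contAt_minus; [apply contAt_const|].
  apply contAt_mult; [apply contAt_const | apply contAt_id].
Qed.

Lemma damp_hol r eps : 0 < r -> 0 < eps -> hol (damp r eps) inH.
Proof.
intros hr he. apply hol_div.
- apply hol_minus; [apply hol_mult; apply hol_id | apply hol_const].
- apply hol_mult; [apply hol_const|]. apply hol_minus; [apply hol_const|].
  apply hol_mult; [apply hol_const | apply hol_id].
- intros z hz. apply damp_den_neq_0; auto. left; exact hz.
Qed.

Lemma damp_le_3 r eps z : 0 < r -> 0 < eps -> rect (- r) r 0 r z -> Cmod (damp r eps z) <= 3.
Proof.
intros hr he [h1 h2]. pose proof (damp_Cmod r eps z hr he ltac:(lra)) as e.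
pose proof (damp_den_re eps z he ltac:(lra)) as hd.
assert (hn : Cmod (z * z - RtoC (r * r))%C <= 3 * (r * r)).
{ unfold Cminus. eapply Rle_trans; [apply Cmod_triangle|].
  rewrite Cmod_opp, Cmod_mult, Cmod_R, Rabs_pos_eq by nra.
  replace (Cmod z * Cmod z) with (Cmod z ^ 2) by ring. rewrite Cmod_sqr.
  assert (fst z ^ 2 <= r * r) by nra. assert (snd z ^ 2 <= r * r) by nra. lra. }
pose proof (Cmod_ge_0 (damp r eps z)). assert (hrr : 0 < r * r) by nra.
set (m := Cmod (damp r eps z)) in *. set (n := Cmod (1 - Ci * RtoC eps * z)%C) in *.
apply Rmult_le_reg_r with (r * r); auto.
assert (m * (r * r) <= m * (r * r * n)) by (apply Rmult_le_compat_l; auto; nra). lra.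
Qed.

Lemma damp_bottom r eps x : 0 < r -> 0 < eps -> - r <= x <= r -> Cmod (damp r eps (x, 0)) <= 1.
Proof.
intros hr he hx. pose proof (damp_Cmod r eps (x, 0) hr he ltac:(simpl; lra)) as e.
pose proof (damp_den_re eps (x, 0) he ltac:(simpl; lra)) as hd.
assert (hn : Cmod ((x, 0) * (x, 0) - RtoC (r * r))%C <= r * r).
{ replace ((x, 0) * (x, 0) - RtoC (r * r))%C with (RtoC (x * x - r * r)) by (apply pair_eq; simpl; ring).
  rewrite Cmod_R, Rabs_left1; nra. }
pose proof (Cmod_ge_0 (damp r eps (x, 0))). assert (hrr : 0 < r * r) by nra.
set (m := Cmod (damp r eps (x, 0))) in *. set (n := Cmod (1 - Ci * RtoC eps * (x, 0))%C) in *.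
apply Rmult_le_reg_r with (r * r); auto.
assert (m * (r * r) <= m * (r * r * n)) by (apply Rmult_le_compat_l; auto; nra). lra.
Qed.

(** The first bound is spent on the blow-up of [q] near the real axis, the second on its growth in
    [r]. On the vertical sides one of [z - r], [z + r] is [i * Im z] and the other has modulus at
    most [3 * r]; on the top side [Im z = r]. *)
Lemma damp_far r eps z : 0 < r -> 0 < eps -> rect (- r) r 0 r z ->
  fst z = - r \/ fst z = r \/ snd z = r ->
  Cmod (damp r eps z) * r <= 3 * snd z /\ Cmod (damp r eps z) * (eps * r) <= 3.
Proof.
intros hr he hz hb. pose proof (damp_le_3 r eps z hr he hz) as h3. destruct hz as [h1 h2].
pose proof (damp_Cmod r eps z hr he ltac:(lra)) as e.
pose proof (damp_den_re eps z he ltac:(lra)) as hd.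
pose proof (Cmod_ge_0 (damp r eps z)) as hm.
assert (hden : eps * r <= Cmod (1 - Ci * RtoC eps * z)%C).
{ pose proof (Rabs_fst_le_Cmod (1 - Ci * RtoC eps * z)%C) as k1.
  pose proof (Rabs_snd_le_Cmod (1 - Ci * RtoC eps * z)%C) as k2. simpl in k1, k2.
  match type of k1 with Rabs ?e <= _ => replace e with (1 + eps * snd z) in k1 by ring end.
  match type of k2 with Rabs ?e <= _ => replace e with (- (eps * fst z)) in k2 by ring end.
  apply Rabs_le_between in k1. apply Rabs_le_between in k2.
  destruct hb as [b|[b|b]]; rewrite b in *; lra. }
assert (hn : Cmod (z * z - RtoC (r * r))%C <= 3 * (r * r)).
{ unfold Cminus. eapply Rle_trans; [apply Cmod_triangle|].
  rewrite Cmod_opp, Cmod_mult, Cmod_R, Rabs_pos_eq by nra.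
  replace (Cmod z * Cmod z) with (Cmod z ^ 2) by ring. rewrite Cmod_sqr.
  assert (fst z ^ 2 <= r * r) by nra. assert (snd z ^ 2 <= r * r) by nra. lra. }
assert (hrr : 0 < r * r) by nra.
split.
- assert (hn2 : Cmod (z * z - RtoC (r * r))%C <= snd z * (3 * r)).
  { destruct hb as [b|[b|b]]; [| |rewrite b; lra];
     (replace (z * z - RtoC (r * r))%C with ((z - RtoC r) * (z + RtoC r))%C
       by (rewrite RtoC_mult; ring)); rewrite Cmod_mult;
     pose proof (Cmod_le_Rabs (z - RtoC r)%C) as k1; pose proof (Cmod_le_Rabs (z + RtoC r)%C) as k2;
     simpl in k1, k2; rewrite b in k1, k2;
     replace (snd z + - 0) with (snd z) in k1 by ring; replace (snd z + 0) with (snd z) in k2 by ring;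
     rewrite (Rabs_pos_eq (snd z)) in k1, k2 by lra.
    - rewrite Rplus_opp_l, Rabs_R0 in k2. rewrite Rabs_left1 in k1 by lra.
      rewrite (Rmult_comm (snd z)). apply Rmult_le_compat; try apply Cmod_ge_0; lra.
    - rewrite Rplus_opp_r, Rabs_R0 in k1. rewrite Rabs_pos_eq in k2 by lra.
      apply Rmult_le_compat; try apply Cmod_ge_0; lra. }
  set (m := Cmod (damp r eps z)) in *. set (n := Cmod (1 - Ci * RtoC eps * z)%C) in *.
  apply Rmult_le_reg_r with r; auto.
  assert (m * (r * r) <= m * (r * r * n)) by (apply Rmult_le_compat_l; auto; nra). lra.
- set (m := Cmod (damp r eps z)) in *. set (n := Cmod (1 - Ci * RtoC eps * z)%C) in *.
  apply Rmult_le_reg_r with (r * r); auto.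
  assert (m * (eps * r * (r * r)) <= m * (r * r * n)) by (apply Rmult_le_compat_l; [auto | rewrite (Rmult_comm (eps * r)); apply Rmult_le_compat_l; lra]). lra.
Qed.

(** At a fixed [z] the damping factor tends to modulus 1 as [eps] decreases and [r] grows; the
    estimate is [(1 - del) / (1 + del) >= 1 - 2 * del]. *)
Lemma damp_lower r eps z del : 0 < r -> 0 < eps -> 0 <= snd z -> 0 < del ->
  Cmod z ^ 2 <= del * (r * r) -> eps * Cmod z <= del -> 1 - 2 * del <= Cmod (damp r eps z).
Proof.
intros hr he hz hdel h1 h2.
pose proof (damp_Cmod r eps z hr he hz) as e. pose proof (damp_den_re eps z he hz) as hd.
pose proof (Cmod_ge_0 (damp r eps z)) as hm.
assert (hn : r * r * (1 - del) <= Cmod (z * z - RtoC (r * r))%C).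
{ pose proof (Cmod_triangle_sub (RtoC (r * r)) (z * z)%C) as t. rewrite Cmod_sub_sym in t.
  rewrite Cmod_mult, Cmod_R, Rabs_pos_eq in t by nra. nra. }
assert (hden : Cmod (1 - Ci * RtoC eps * z)%C <= 1 + del).
{ unfold Cminus. eapply Rle_trans; [apply Cmod_triangle|].
  rewrite Cmod_opp, !Cmod_mult, Cmod_1, Cmod_Ci, Cmod_R, Rabs_pos_eq by lra. lra. }
set (m := Cmod (damp r eps z)) in *. set (n := Cmod (1 - Ci * RtoC eps * z)%C) in *.
assert (hrr : 0 < r * r) by nra.
assert (k : 1 - del <= m * n).
{ apply Rmult_le_reg_l with (r * r); auto. nra. }
assert (m * n <= m * (1 + del)) by (apply Rmult_le_compat_l; auto).
apply Rnot_lt_le. intros hlt. nra.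
Qed.

Lemma bernoulli_sub u n : 0 <= u <= 1 -> 1 - INR n * u <= (1 - u) ^ n.
Proof.
intros hu. induction n as [|n IH]; [simpl; lra|].
rewrite S_INR. simpl. pose proof (pos_INR n).
destruct (Rle_dec 0 (1 - INR n * u)) as [h|h].
- apply Rle_trans with ((1 - u) * (1 - INR n * u)); [|apply Rmult_le_compat_l; lra].
  assert (0 <= u * (INR n * u)) by nra. nra.
- assert (0 <= (1 - u) * (1 - u) ^ n) by (apply Rmult_le_pos; [lra | apply pow_le; lra]). nra.
Qed.

(** If [|q z| > c] at some fixed [z], multiply [q] by a power of [damp] that brings it below [c] on
    the boundary of a large rectangle yet hardly changes it at [z]. The order of choice matters:
    [eps] depends on [z] only, and [r] is taken large afterwards. *)
Lemma phragmen_lindelof (q : C -> C) (c A : R) (p : nat) : 0 < c -> 0 <= A ->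
  (forall r eta, 0 < r -> 0 < eta -> exists h, contOn (rect (- r) r 0 r) h /\ hol h inH /\
     forall z, rect (- r) r 0 r z -> Cmod (h z - q z)%C <= eta) ->
  (forall x, Cmod (q (x, 0)) <= c) ->
  (forall x y Y, 0 < y <= Y -> 1 <= Y -> Rabs x <= Y -> y ^ p * Cmod (q (x, y)) <= A * Y ^ (2 * p)) ->
  forall z, inH z -> Cmod (q z) <= c.
Proof.
intros hc hA happ hR hgr z hz. unfold inH, Im in hz.
apply Rnot_lt_le. intros hlt. set (m := Cmod (q z)) in *.
(* On the far sides [p] factors absorb [y ^ p] and leave a bound of order [r ^ p]; the other [p + 1]
   factors, each of order [1 / (eps * r)], reduce this to [B / r]. *)
set (N := (2 * p + 1)%nat).
assert (hN : 1 <= INR N) by (apply (le_INR 1); unfold N; lia).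
(* With this [del] the [N] factors lower the value at [z] to no less than [m - (m - c) / 2], still
   above [c]. *)
set (del := (m - c) / (4 * INR N * m)).
assert (hdel : 0 < del) by (apply Rdiv_lt_0_compat; nra).
assert (hdelm : 2 * INR N * del * m = (m - c) / 2) by (unfold del; field; lra).
assert (hdel1 : 2 * del <= 1).
{ assert (2 * del * m <= (m - c) / 2) by nra. nra. }
pose proof (Cmod_ge_0 z) as hz0.
set (eps := del / (Cmod z + 1)).
assert (heps : 0 < eps) by (apply Rdiv_lt_0_compat; lra).
assert (hepsz : eps * Cmod z <= del).
{ assert (eps * (Cmod z + 1) = del) by (unfold eps; field; lra). nra. }
set (B := 3 ^ p * (3 / eps) ^ (p + 1) * A).
assert (hB : 0 <= B).
{ unfold B. apply Rmult_le_pos; auto. apply Rmult_le_pos; apply pow_le; [lra|].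
  left; apply Rdiv_lt_0_compat; lra. }
(* One summand for each demand: [1 <= r] in the growth bound, [z] inside the rectangle, numerator of
   [damp] close to [r * r] at [z], and [B / r <= c] on the far sides. *)
set (r := 1 + Cmod z + Cmod z ^ 2 / del + B / c).
assert (hr0 : 0 <= Cmod z ^ 2 / del) by (apply Rmult_le_pos; [apply pow2_ge_0 | left; apply Rinv_0_lt_compat; auto]).
assert (hr1 : 0 <= B / c) by (apply Rmult_le_pos; [auto | left; apply Rinv_0_lt_compat; auto]).
assert (hr : 1 <= r) by (unfold r; lra).
assert (hrz : Cmod z <= r) by (unfold r; lra).
assert (hrd : Cmod z ^ 2 <= del * (r * r)).
{ assert (Cmod z ^ 2 / del <= r) by (unfold r; lra).
  assert (Cmod z ^ 2 = del * (Cmod z ^ 2 / del)) by (field; lra). rewrite H0.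
  apply Rmult_le_compat_l; nra. }
assert (hrB : B <= c * r).
{ assert (B / c <= r) by (unfold r; lra). assert (B = c * (B / c)) by (field; lra). rewrite H0.
  apply Rmult_le_compat_l; lra. }
assert (hzr : rect (- r) r 0 r z).
{ pose proof (Rabs_fst_le_Cmod z) as k1. pose proof (Rabs_snd_le_Cmod z) as k2.
  assert (k1' : Rabs (fst z) <= r) by lra. assert (k2' : Rabs (snd z) <= r) by lra.
  apply Rabs_le_between in k1'. apply Rabs_le_between in k2'. unfold rect. lra. }
clearbody r.
assert (hmax : Cmod (damp r eps z ^ N * q z)%C <= c).
{ apply (max_principle_lim (- r) r 0 r (fun w => damp r eps w ^ N * q w)%C); auto; try lra.
  - intros eta heta. assert (h3N : 0 < 3 ^ N) by (apply pow_lt; lra).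
    destruct (happ r (eta / 3 ^ N)) as [h [hh1 [hh2 hh3]]]; [lra | apply Rdiv_lt_0_compat; auto |].
    exists (fun w => damp r eps w ^ N * h w)%C. split; [|split].
    + intros w hw. apply contAt_mult; auto. apply contAt_pow, damp_cont; try lra. apply hw.
    + intros w hw. apply hol_punctured with inH; [apply inH_Copen | apply hw |].
      apply hol_mult; auto. apply hol_pow, damp_hol; lra.
    + intros w hw. replace (damp r eps w ^ N * h w - damp r eps w ^ N * q w)%C
        with (damp r eps w ^ N * (h w - q w))%C by ring.
      rewrite Cmod_mult, Cmod_pow.
      replace eta with (3 ^ N * (eta / 3 ^ N)) by (field; lra).
      apply Rmult_le_compat; auto using Cmod_ge_0.
      * apply pow_le, Cmod_ge_0.
      * apply pow_incr. split; [apply Cmod_ge_0 | apply damp_le_3; auto; lra].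
  - intros w [hw hb]. rewrite Cmod_mult, Cmod_pow.
    destruct (Req_dec (snd w) 0) as [h0|h0].
    + rewrite (surjective_pairing w), h0.
      assert (h1 : Cmod (damp r eps (fst w, 0)) <= 1) by (apply damp_bottom; [lra | auto | apply hw]).
      assert (h2 : Cmod (damp r eps (fst w, 0)) ^ N <= 1).
      { rewrite <- (pow1 N). apply pow_incr. split; [apply Cmod_ge_0 | auto]. }
      specialize (hR (fst w)). pose proof (Cmod_ge_0 (q (fst w, 0))).
      apply Rle_trans with (1 * Cmod (q (fst w, 0))); [|lra]. apply Rmult_le_compat_r; auto.
    + destruct (damp_far r eps w) as [d1 d2]; auto; [lra | tauto |].
      destruct hw as [hw1 hw2].
      assert (hg := hgr (fst w) (snd w) r ltac:(lra) hr ltac:(apply Rabs_le; lra)).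
      rewrite <- surjective_pairing in hg.
      pose proof (Cmod_ge_0 (damp r eps w)) as ht. set (T := Cmod (damp r eps w)) in *.
      pose proof (Cmod_ge_0 (q w)) as hq. set (Q := Cmod (q w)) in *.
      assert (p1 : (T * r) ^ p <= (3 * snd w) ^ p) by (apply pow_incr; split; nra).
      assert (p2 : (T * (eps * r)) ^ (p + 1) <= 3 ^ (p + 1)) by (apply pow_incr; split; [apply Rmult_le_pos; nra | auto]).
      assert (herp : 0 < (eps * r) ^ (p + 1)) by (apply pow_lt; nra).
      assert (hrp : 0 < r ^ p) by (apply pow_lt; lra).
      assert (p3 : T ^ (p + 1) <= (3 / eps) ^ (p + 1) / r ^ (p + 1)).
      { apply Rmult_le_reg_r with ((eps * r) ^ (p + 1)); auto. rewrite <- Rpow_mult_distr.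
        apply Rle_trans with (1 := p2). right. unfold Rdiv. rewrite !Rpow_mult_distr, pow_inv. field.
        split; apply pow_nonzero; lra. }
      assert (p4 : T ^ p * Q <= 3 ^ p * A * r ^ p).
      { apply Rmult_le_reg_r with (r ^ p); auto.
        replace (T ^ p * Q * r ^ p) with ((T * r) ^ p * Q) by (rewrite Rpow_mult_distr; ring).
        apply Rle_trans with ((3 * snd w) ^ p * Q); [apply Rmult_le_compat_r; auto|].
        rewrite Rpow_mult_distr. replace (2 * p)%nat with (p + p)%nat in hg by lia. rewrite pow_add in hg.
        assert (0 < 3 ^ p) by (apply pow_lt; lra).
        replace (3 ^ p * A * r ^ p * r ^ p) with (3 ^ p * (A * (r ^ p * r ^ p))) by ring.
        rewrite Rmult_assoc. apply Rmult_le_compat_l; lra. }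
      replace N with (p + 1 + p)%nat by (unfold N; lia). rewrite pow_add, Rmult_assoc.
      apply Rle_trans with ((3 / eps) ^ (p + 1) / r ^ (p + 1) * (3 ^ p * A * r ^ p)).
      * apply Rmult_le_compat; auto; [apply pow_le; auto | apply Rmult_le_pos; [apply pow_le; auto | auto]].
      * replace ((3 / eps) ^ (p + 1) / r ^ (p + 1) * (3 ^ p * A * r ^ p)) with (B / r).
        { apply Rmult_le_reg_r with r; [lra|]. unfold Rdiv. rewrite Rmult_assoc, Rinv_l; lra. }
        unfold B. rewrite (pow_add r p 1), pow_1. field. split; lra. }
rewrite Cmod_mult, Cmod_pow in hmax. fold m in hmax.
assert (hlow := damp_lower r eps z del ltac:(lra) heps ltac:(lra) hdel hrd hepsz).
assert (hpow : 1 - INR N * (2 * del) <= Cmod (damp r eps z) ^ N).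
{ apply Rle_trans with ((1 - 2 * del) ^ N); [apply bernoulli_sub; lra|].
  apply pow_incr. lra. }
assert ((1 - INR N * (2 * del)) * m <= Cmod (damp r eps z) ^ N * m) by (apply Rmult_le_compat_r; lra).
nra.
Qed.

(** * The boundary derivative *)

(** The scalar mean value theorem is applied to the inner product of [g] with its total increment
    [d], whose increment is [|d|^2]. *)
Lemma mean_value_ineq (g g' : R -> C) a b M : a < b ->
  (forall t, a <= t <= b -> is_derive (fun s => fst (g s)) t (fst (g' t)) /\
     is_derive (fun s => snd (g s)) t (snd (g' t))) ->
  (forall t, a <= t <= b -> Cmod (g' t) <= M) -> Cmod (g b - g a)%C <= M * (b - a).
Proof.
intros hab hd hM. set (d := (g b - g a)%C).
set (phi := fun s => fst d * fst (g s) + snd d * snd (g s)).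
set (dphi := fun s => fst d * fst (g' s) + snd d * snd (g' s)).
assert (hphi : forall t, a <= t <= b -> is_derive phi t (dphi t)).
{ intros t ht. destruct (hd t ht) as [h1 h2].
  apply (is_derive_plus (V := R_NormedModule) (fun s => fst d * fst (g s)) (fun s => snd d * snd (g s)));
   apply (is_derive_scal (fun s => _)); auto. }
destruct (MVT_gen phi a b dphi) as [t [ht e]].
{ intros t ht. rewrite Rmin_left, Rmax_right in ht by lra. apply hphi. lra. }
{ intros t ht. rewrite Rmin_left, Rmax_right in ht by lra.
  apply continuity_pt_filterlim, (ex_derive_continuous (V := R_NormedModule)). eexists. apply hphi; auto. }
rewrite Rmin_left, Rmax_right in ht by lra.
assert (hdd : phi b - phi a = Cmod d ^ 2).
{ rewrite Cmod_sqr. unfold phi, d. simpl. ring. }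
assert (hle : dphi t <= Cmod d * M).
{ apply Rle_trans with (Rabs (fst (Cconj d * g' t)%C)).
  - eapply Rle_trans; [|apply Rle_abs]. right. unfold dphi. simpl. ring.
  - eapply Rle_trans; [apply Rabs_fst_le_Cmod|]. rewrite Cmod_mult, Cmod_conj.
    apply Rmult_le_compat_l; [apply Cmod_ge_0 | auto]. }
pose proof (Cmod_ge_0 d) as h0. rewrite hdd in e.
destruct (Req_dec (Cmod d) 0) as [e0|e0].
- rewrite e0. pose proof (Cmod_ge_0 (g' t)). specialize (hM t ht). nra.
- assert (Cmod d * Cmod d <= Cmod d * (M * (b - a))) by nra.
  apply Rmult_le_reg_l with (Cmod d); lra.
Qed.

Lemma mean_value_ineq_segment (f f' : C -> C) z w M :
  (forall t, 0 <= t <= 1 -> is_cderiv f (ray z w t) (f' (ray z w t)) /\ Cmod (f' (ray z w t)) <= M) ->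
  Cmod (f w - f z)%C <= M * Cmod (w - z)%C.
Proof.
intros h.
assert (hm : Cmod (f (ray z w 1) - f (ray z w 0))%C <= M * Cmod (w - z)%C * (1 - 0)).
{ apply (mean_value_ineq (fun t => f (ray z w t)) (fun t => f' (ray z w t) * (w - z))%C); [lra| |].
  - intros t ht.
    destruct (cderiv_curve f (fun t => fst z + t * fst (w - z)%C) (fun t => snd z + t * snd (w - z)%C) t
      (fst (w - z)%C) (snd (w - z)%C) (f' (ray z w t))) as [d1 d2].
    + auto_derive; auto. simpl. ring.
    + auto_derive; auto. simpl. ring.
    + apply h, ht.
    + split; [exact d1|]. rewrite Rplus_comm in d2. exact d2.
  - intros t ht. rewrite Cmod_mult. apply Rmult_le_compat_r; [apply Cmod_ge_0 | apply h, ht]. }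
replace (ray z w 1) with w in hm by (apply pair_eq; simpl; ring).
replace (ray z w 0) with z in hm by (apply pair_eq; simpl; ring). lra.
Qed.

(** * The equality case: derivatives of constant modulus *)

Lemma RInt_nonneg_eq_0 (psi : R -> R) a b : a < b -> (forall t, continuity_pt psi t) ->
  (forall t, 0 <= psi t) -> RInt psi a b = 0 -> forall t, a < t < b -> psi t = 0.
Proof.
intros hab hc hp hI t ht. apply NNPP. intros hne.
assert (hpt : 0 < psi t) by (pose proof (hp t); lra).
destruct (hc t (psi t) hpt) as [d [hd h]].
set (e := Rmin (d / 2) (Rmin (t - a) (b - t))).
assert (he : 0 < e) by (repeat apply Rmin_pos; lra).
assert (he' : e < d /\ e <= t - a /\ e <= b - t).
{ unfold e. pose proof (Rmin_l (d / 2) (Rmin (t - a) (b - t))); pose proof (Rmin_r (d / 2) (Rmin (t - a) (b - t))).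
  pose proof (Rmin_l (t - a) (b - t)); pose proof (Rmin_r (t - a) (b - t)). lra. }
assert (hi : forall u v, ex_RInt psi u v).
{ intros u v. apply (ex_RInt_continuous (V := R_CompleteNormedModule)). intros. apply continuity_pt_filterlim, hc. }
assert (h1 := RInt_Chasles (V := R_CompleteNormedModule) psi a (t - e) b (hi _ _) (hi _ _)).
assert (h2 := RInt_Chasles (V := R_CompleteNormedModule) psi (t - e) (t + e) b (hi _ _) (hi _ _)).
change (RInt psi a (t - e) + RInt psi (t - e) b = RInt psi a b) in h1.
change (RInt psi (t - e) (t + e) + RInt psi (t + e) b = RInt psi (t - e) b) in h2.
assert (0 <= RInt psi a (t - e)) by (apply RInt_ge_0; auto; lra).
assert (0 <= RInt psi (t + e) b) by (apply RInt_ge_0; auto; lra).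
assert (0 < RInt psi (t - e) (t + e)).
{ apply RInt_gt_0; [lra| |].
  - intros x hx. destruct (Req_dec x t) as [->|hxt]; auto.
    assert (hx' : R_dist (psi x) (psi t) < psi t).
    { apply h. split; [split; [exact I | auto] | apply Rabs_def1; lra]. }
    apply Rabs_def2 in hx'. lra.
  - intros x _. apply continuity_pt_filterlim, hc. }
lra.
Qed.

(** For points below the centre the angle is [2 * PI - acos (u / s)], strictly inside the interval
    of integration, so no discussion of the argument is required. Lower points are enough, as any
    two points lie below a common high one. *)
Lemma polar_below (z w : C) : snd w < snd z ->
  exists t, 0 < t < 2 * PI /\ w = circ z (Cmod (w - z)%C) t.
Proof.
intros h. set (s := Cmod (w - z)%C). set (u := fst w - fst z). set (v := snd w - snd z).
assert (hs : s ^ 2 = u ^ 2 + v ^ 2) by (unfold s; rewrite Cmod_sqr; reflexivity).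
assert (hs0 : 0 < s).
{ apply Cmod_gt_0. intros e. apply (f_equal snd) in e. simpl in e. lra. }
assert (hv : v < 0) by (unfold v; lra).
assert (hu : -1 < u / s < 1).
{ assert (hus : - s < u < s) by (split; nra).
  split; apply Rmult_lt_reg_r with s; auto; unfold Rdiv; rewrite Rmult_assoc, Rinv_l; lra. }
pose proof (acos_bound_lt _ hu) as hb. pose proof PI_RGT_0.
exists (2 * PI - acos (u / s)). split; [lra|].
assert (hc : cos (2 * PI - acos (u / s)) = u / s).
{ rewrite cos_minus, cos_2PI, sin_2PI, cos_acos by lra. ring. }
assert (hsn : sin (2 * PI - acos (u / s)) = v / s).
{ rewrite sin_minus, cos_2PI, sin_2PI, sin_acos by lra.
  replace (1 - Rsqr (u / s)) with (Rsqr (- v / s)).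
  - rewrite sqrt_Rsqr; [field; lra|]. apply Rmult_le_pos; [lra | left; apply Rinv_0_lt_compat; auto].
  - unfold Rsqr. apply Rmult_eq_reg_r with (s * s); [|nra].
    replace (- v / s * (- v / s) * (s * s)) with (v ^ 2) by (field; lra).
    replace ((1 - u / s * (u / s)) * (s * s)) with (s ^ 2 - u ^ 2) by (field; lra). lra. }
unfold circ. rewrite hc, hsn. unfold u, v. apply pair_eq; simpl; field; lra.
Qed.

(* The slope function [q] of [f] at [z0] satisfies [|q| <= k = |q z0|]; equality in the mean value property makes it constant. *)
Lemma const_modulus_slope (f f' : C -> C) k z0 w :
  (forall z, inH z -> is_cderiv f z (f' z) /\ contAt full f' z) ->
  (forall z, inH z -> Cmod (f' z) = k) -> inH z0 -> Cmod (w - z0)%C < snd z0 -> snd w < snd z0 ->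
  (f w - f z0 = f' z0 * (w - z0))%C.
Proof.
intros hf hk hz0 hw hlow.
assert (hh : hol f inH) by (exists f'; auto).
set (s := Cmod (w - z0)%C) in *.
assert (hs : 0 < s).
{ apply Cmod_gt_0. intros e. apply (f_equal snd) in e. simpl in e. lra. }
assert (hball : forall v, Cmod (v - z0)%C < snd z0 -> inH v).
{ intros v hv. pose proof (Rabs_snd_le_Cmod (v - z0)%C) as h.
  assert (h' : Rabs (snd (v - z0)%C) < snd z0) by lra. apply Rabs_def2 in h'. simpl in h'.
  unfold inH, Im. lra. }
set (a := f' z0). set (q := dq f a z0).
assert (hq : forall v, Cmod (v - z0)%C < snd z0 -> v <> z0 -> Cmod (q v) <= k).
{ intros v hv hne. apply Csub_neq_0, Cmod_gt_0 in hne.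
  apply Rmult_le_reg_r with (Cmod (v - z0)%C); auto. rewrite <- Cmod_mult. unfold q. rewrite <- dq_mult.
  apply (mean_value_ineq_segment f f'). intros t ht.
  assert (ht' : inH (ray z0 v t)).
  { apply hball. eapply Rle_lt_trans; [|apply hv].
    pose proof (ray_sub_le z0 z0 v t ht) as h. replace (ray z0 z0 t) with z0 in h; auto.
    apply pair_eq; simpl; ring. }
  split; [apply hf; auto | right; apply hk; auto]. }
set (G := fun v => (Cconj a * q v)%C).
assert (hGc : forall v, Cmod (v - z0)%C < snd z0 -> contAt full G v).
{ intros v hv. apply contAt_mult; [apply contAt_const|]. apply dq_cont with inH; auto.
  - apply inH_Copen.
  - apply hf; auto. }
assert (hcirc : forall t, Cmod (circ z0 s t - z0)%C = s) by (intros; apply circ_dist; lra).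
assert (hmv : RInt (fun t => fst (G (circ z0 s t))) 0 (2 * PI) = 2 * PI * fst (G z0)).
{ apply mean_value with (snd z0); [| |lra].
  - apply hGc. rewrite Cmod_sub_self. exact hz0.
  - apply hol_mult; [apply hol_const|].
    eapply hol_subset; [|apply (dq_hol f a z0 inH inH_Copen hh)].
    intros v [hv1 hv2]. split; auto. intros ->. rewrite Cmod_sub_self in hv1. lra. }
assert (hak : Cmod a = k) by (apply hk; auto).
assert (hGz : fst (G z0) = k ^ 2).
{ unfold G, q. rewrite dq_at, <- hak, Cmod_sqr. simpl. ring. }
destruct (polar_below z0 w hlow) as [t0 [ht0 ew]]. fold s in ew.
set (psi := fun t => k ^ 2 - fst (G (circ z0 s t))).
assert (hpsi : psi t0 = 0).
{ pose proof PI_RGT_0.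
  apply (RInt_nonneg_eq_0 psi 0 (2 * PI)); auto; [lra| | |].
  - intros t. apply continuity_pt_minus; [reg|]. apply circ_continuity, hGc. rewrite hcirc; auto.
  - intros t. unfold psi. assert (Cmod (G (circ z0 s t)) <= k * k).
    { unfold G. rewrite Cmod_mult, Cmod_conj, hak. apply Rmult_le_compat_l; [rewrite <- hak; apply Cmod_ge_0|].
      apply hq; [rewrite hcirc; auto|]. intros e. specialize (hcirc t). rewrite e, Cmod_sub_self in hcirc. lra. }
    pose proof (Rabs_fst_le_Cmod (G (circ z0 s t))). pose proof (Rle_abs (fst (G (circ z0 s t)))). lra.
  - assert (i1 : ex_RInt (fun _ : R => k ^ 2) 0 (2 * PI)) by apply ex_RInt_const.
    assert (i2 : ex_RInt (fun t => fst (G (circ z0 s t))) 0 (2 * PI)).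
    { apply circ_ex_RInt. intros t. apply hGc. rewrite hcirc; auto. }
    assert (ei := RInt_minus (V := R_CompleteNormedModule) _ _ _ _ i1 i2).
    change (RInt psi 0 (2 * PI) = RInt (fun _ => k ^ 2) 0 (2 * PI) - RInt (fun t => fst (G (circ z0 s t))) 0 (2 * PI)) in ei.
    rewrite ei, hmv, hGz, RInt_const. change ((2 * PI - 0) * k ^ 2 - 2 * PI * k ^ 2 = 0). ring. }
unfold psi in hpsi. rewrite <- ew in hpsi.
assert (hqw : Cmod (q w) <= k).
{ apply hq; auto. intros e. rewrite e in hlow. lra. }
(* Expanding, [|q w - a|^2 = |q w|^2 - 2 * Re (conj a * q w) + |a|^2 <= k^2 - 2 * k^2 + k^2]. *)
assert (e : q w = a).
{ apply NNPP. intros hne. apply Csub_neq_0, Cmod_gt_0 in hne.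
  assert (h1 : Cmod (q w - a)%C ^ 2 = Cmod (q w) ^ 2 - 2 * fst (G w) + Cmod a ^ 2).
  { rewrite !Cmod_sqr. unfold G. simpl. ring. }
  assert (Cmod (q w) ^ 2 <= k ^ 2) by (apply pow_incr; split; auto using Cmod_ge_0).
  rewrite hak in h1. assert (0 < Cmod (q w - a)%C ^ 2) by (apply pow_lt; auto). lra. }
rewrite (dq_mult f a z0). fold q. rewrite e. reflexivity.
Qed.

(** Near a point [z] below [z0], in the disc about [z0] tangent to the real axis, [f] coincides with
    an affine map of slope [f' z0]. For large [Y] the disc about [(0, Y)] contains both given
    points, since [|z - iY| < Y] means [|z|^2 < 2 * Y * Im z]. *)
Lemma const_modulus_deriv (f f' : C -> C) k :
  (forall z, inH z -> is_cderiv f z (f' z) /\ contAt full f' z) ->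
  (forall z, inH z -> Cmod (f' z) = k) -> forall z1 z2, inH z1 -> inH z2 -> f' z1 = f' z2.
Proof.
intros hf hk.
assert (h : forall z0 z, inH z0 -> inH z -> Cmod (z - z0)%C < snd z0 -> snd z < snd z0 -> f' z = f' z0).
{ intros z0 z hz0 hz hd hl. set (r := Rmin (snd z0 - Cmod (z - z0)%C) (snd z0 - snd z)).
  assert (hr : 0 < r) by (apply Rmin_pos; lra).
  apply (cderiv_unique f z); [apply hf; auto|].
  apply (cderiv_ext_loc (fun w => f z0 + f' z0 * (w - z0))%C _ z _ r); auto.
  - intros w hw. pose proof (Rmin_l (snd z0 - Cmod (z - z0)%C) (snd z0 - snd z)) as m1. fold r in m1.
    pose proof (Rmin_r (snd z0 - Cmod (z - z0)%C) (snd z0 - snd z)) as m2. fold r in m2.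
    rewrite <- (const_modulus_slope f f' k z0 w); auto; [ring| |].
    + pose proof (Cmod_sub_triangle w z z0). lra.
    + pose proof (Rabs_snd_le_Cmod (w - z)%C) as h. assert (h' : Rabs (snd (w - z)%C) < r) by lra.
      apply Rabs_def2 in h'. simpl in h'. lra.
  - assert (hD : is_cderiv (fun w => f z0 + f' z0 * (w - z0))%C z
      (RtoC 0 + (RtoC 0 * (z - z0) + f' z0 * (RtoC 1 + RtoC 0)))%C).
    { apply (cderiv_plus (fun _ => f z0) (fun w => f' z0 * (w - z0))%C); [apply cderiv_const|].
      apply (cderiv_mult (fun _ => f' z0) (fun w => w - z0)%C); [apply cderiv_const|].
      apply (cderiv_plus (fun w => w) (fun _ => - z0)%C); [apply cderiv_id | apply cderiv_const]. }
    replace (RtoC 0 + (RtoC 0 * (z - z0) + f' z0 * (RtoC 1 + RtoC 0)))%C with (f' z0) in hD by ring.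
    exact hD. }
intros z1 z2 h1 h2. unfold inH, Im in h1, h2.
set (n1 := Cmod z1 ^ 2). set (n2 := Cmod z2 ^ 2).
pose proof (pow2_ge_0 (Cmod z1)) as p1. pose proof (pow2_ge_0 (Cmod z2)) as p2.
assert (hY : forall z, 0 < snd z -> forall Y, Cmod z ^ 2 / snd z < Y -> snd z < Y /\ Cmod (z - (0, Y))%C < Y).
{ intros z hz Y hlt. assert (e : Cmod z ^ 2 < Y * snd z).
  { apply Rmult_lt_compat_r with (r := snd z) in hlt; auto.
    replace (Cmod z ^ 2 / snd z * snd z) with (Cmod z ^ 2) in hlt by (field; lra). lra. }
  rewrite Cmod_sqr in e. assert (snd z < Y) by nra. split; auto.
  apply Rnot_le_lt. intros hle. assert (Y ^ 2 <= Cmod (z - (0, Y))%C ^ 2) by (apply pow_incr; lra).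
  rewrite Cmod_sqr in H0. simpl in H0. nra. }
set (Y := Rmax (Cmod z1 ^ 2 / snd z1) (Cmod z2 ^ 2 / snd z2) + 1).
destruct (hY z1 h1 Y) as [a1 b1].
{ unfold Y. pose proof (Rmax_l (Cmod z1 ^ 2 / snd z1) (Cmod z2 ^ 2 / snd z2)). lra. }
destruct (hY z2 h2 Y) as [a2 b2].
{ unfold Y. pose proof (Rmax_r (Cmod z1 ^ 2 / snd z1) (Cmod z2 ^ 2 / snd z2)). lra. }
transitivity (f' (0, Y)); [|symmetry]; apply h; auto; unfold inH, Im; simpl; lra.
Qed.

(** * Real differentiability up to the boundary and difference quotients *)

Lemma cderiv_fx (f Fx Fy : C -> C) z : holomorphic_on_H f -> C1_on_Hbar f Fx Fy -> inH z ->
  is_cderiv f z (Fx z).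
Proof.
intros hhol [hd _] hz. destruct (hhol z hz) as [L hL].
replace (Fx z) with L; auto. apply NNPP. intros hne. apply Csub_neq_0, Cmod_gt_0 in hne.
assert (hzb : inHbar z) by (unfold inH, inHbar in *; lra).
set (e := Cmod (L - Fx z)%C) in *.
destruct (proj1 (is_cderiv_eq f z L) hL (e / 4)) as [d1 [hd1 h1]]; [lra|].
destruct (hd z hzb (e / 4)) as [d2 [hd2 h2]]; [lra|].
set (t := Rmin d1 d2 / 2). assert (hm : 0 < Rmin d1 d2) by (apply Rmin_pos; auto).
pose proof (Rmin_l d1 d2); pose proof (Rmin_r d1 d2).
set (w := (z + RtoC t)%C).
assert (hw : Cmod (w - z)%C = t).
{ unfold w. replace (z + RtoC t - z)%C with (RtoC t) by ring. rewrite Cmod_R, Rabs_pos_eq; unfold t; lra. }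
specialize (h1 w ltac:(rewrite hw; unfold t; lra)).
change (forall w, inHbar w -> Cmod (w - z)%C < d2 ->
  Cmod (f w - f z - Cadd (Cscal (fst (w - z)%C) (Fx z)) (Cscal (snd (w - z)%C) (Fy z)))%C <= e / 4 * Cmod (w - z)%C) in h2.
specialize (h2 w). rewrite hw in h1, h2.
assert (hwb : inHbar w) by (unfold inHbar, w, Im in *; simpl; lra).
specialize (h2 hwb ltac:(unfold t; lra)).
replace (Cadd (Cscal (fst (w - z)%C) (Fx z)) (Cscal (snd (w - z)%C) (Fy z))) with (Fx z * (w - z))%C in h2
  by (apply pair_eq; unfold w; simpl; unfold Re, Im; ring).
assert (h3 : Cmod ((L - Fx z) * (w - z))%C <= e / 4 * t + e / 4 * t).
{ replace ((L - Fx z) * (w - z))%C with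
   ((f w - f z - Fx z * (w - z)) - (f w - f z - L * (w - z)))%C by ring.
  eapply Rle_trans; [apply Cmod_triangle|]. rewrite Cmod_opp. lra. }
rewrite Cmod_mult, hw in h3. fold e in h3. unfold t in h3. nra.
Qed.

Lemma real_diff_bound (f : C -> C) (fx fy z : C) : real_diff_Hbar f fx fy z ->
  forall eps, 0 < eps -> exists d, 0 < d /\ forall w, inHbar w -> Cmod (w - z)%C < d ->
    Cmod (f w - f z - (RtoC (fst (w - z)%C) * fx + RtoC (snd (w - z)%C) * fy))%C <= eps * Cmod (w - z)%C.
Proof.
intros h eps he. destruct (h eps he) as [d [hd hw]]. exists d; split; auto.
intros w hwb hwd. specialize (hw w hwb hwd).
match type of hw with Cnorm ?e <= _ => replace e with
 (f w - f z - (RtoC (fst (w - z)%C) * fx + RtoC (snd (w - z)%C) * fy))%C in hw end; auto.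
apply pair_eq; simpl; unfold Re, Im; simpl; ring.
Qed.

Lemma real_diff_contAt (f : C -> C) (fx fy z : C) : real_diff_Hbar f fx fy z -> contAt inHbar f z.
Proof.
intros h eps he. destruct (real_diff_bound _ _ _ _ h 1) as [d [hd hw]]; [lra|].
pose proof (Cmod_ge_0 fx); pose proof (Cmod_ge_0 fy).
set (K := 1 + Cmod fx + Cmod fy). assert (hK : 0 < K) by (unfold K; lra).
exists (Rmin d (eps / K)); split; [apply Rmin_pos; auto; apply Rdiv_lt_0_compat; auto|].
intros w hwb hwd. pose proof (Rmin_l d (eps / K)); pose proof (Rmin_r d (eps / K)).
specialize (hw w hwb ltac:(lra)).
pose proof (Cmod_triangle_sub (f w - f z)%C (RtoC (fst (w - z)%C) * fx + RtoC (snd (w - z)%C) * fy)%C) as t.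
pose proof (Cmod_triangle (RtoC (fst (w - z)%C) * fx) (RtoC (snd (w - z)%C) * fy)) as t2.
rewrite !Cmod_mult, !Cmod_R in t2.
pose proof (Rabs_fst_le_Cmod (w - z)%C) as k1. pose proof (Rabs_snd_le_Cmod (w - z)%C) as k2.
assert (Rabs (fst (w - z)%C) * Cmod fx <= Cmod (w - z)%C * Cmod fx) by (apply Rmult_le_compat_r; auto).
assert (Rabs (snd (w - z)%C) * Cmod fy <= Cmod (w - z)%C * Cmod fy) by (apply Rmult_le_compat_r; auto).
assert (hle : Cmod (f w - f z)%C <= K * Cmod (w - z)%C) by (unfold K; lra).
apply Rle_lt_trans with (1 := hle).
replace eps with (K * (eps / K)) by (field; lra). apply Rmult_lt_compat_l; auto. lra.
Qed.

Lemma real_diff_derive (f : C -> C) (fx fy : C) (x y : R) : 0 <= y -> real_diff_Hbar f fx fy (x, y) ->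
  is_derive (fun s => fst (f (s, y))) x (fst fx) /\ is_derive (fun s => snd (f (s, y))) x (snd fx).
Proof.
intros hy h.
assert (hlim : forall pr : C -> R, (forall z, Rabs (pr z) <= Cmod z) ->
  (forall z w, pr (z - w)%C = pr z - pr w) -> (forall t z, pr (RtoC t * z)%C = t * pr z) ->
  is_derive (fun s => pr (f (s, y))) x (pr fx)).
{ intros pr h1 h2 h3. apply is_derive_Reals. intros eps he.
  destruct (real_diff_bound _ _ _ _ h (eps / 2)) as [d [hd hw]]; [lra|].
  exists (mkposreal d hd). simpl. intros t ht0 htd.
  specialize (hw (x + t, y) ltac:(unfold inHbar, Im; simpl; lra)).
  replace (((x + t)%R, y) - (x, y))%C with (RtoC t) in hw by (apply pair_eq; simpl; ring).
  rewrite Cmod_R in hw. specialize (hw htd). simpl in hw.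
  replace (RtoC t * fx + RtoC 0 * fy)%C with (RtoC t * fx)%C in hw by ring.
  assert (hp := h1 (f ((x + t)%R, y) - f (x, y) - RtoC t * fx)%C). rewrite !h2, h3 in hp.
  replace ((pr (f (x + t, y)%R) - pr (f (x, y))) / t - pr fx) with
    ((pr (f (x + t, y)%R) - pr (f (x, y)) - t * pr fx) / t) by (field; auto).
  unfold Rdiv. rewrite Rabs_mult, Rabs_inv. pose proof (Rabs_pos_lt t ht0) as hta.
  apply Rmult_lt_reg_r with (Rabs t); auto. rewrite Rmult_assoc, Rinv_l by lra. nra. }
split.
- apply (hlim fst); [apply Rabs_fst_le_Cmod | reflexivity | intros; simpl; ring].
- apply (hlim snd); [apply Rabs_snd_le_Cmod | reflexivity | intros; simpl; ring].
Qed.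

(** The mean value inequality for [f (s, y) - L * s]. Only differentiability along the horizontal
    line is involved, so the real axis [y = 0] is included. *)
Lemma increment_approx (f Fx Fy : C -> C) (x1 x2 y : R) (L : C) eta : x1 < x2 -> 0 <= y ->
  C1_on_Hbar f Fx Fy -> (forall x, x1 <= x <= x2 -> Cmod (Fx (x, y) - L)%C <= eta) ->
  Cmod (f (x2, y) - f (x1, y) - L * RtoC (x2 - x1)%R)%C <= eta * (x2 - x1).
Proof.
intros hx hy [hd _] hb.
replace (f (x2, y) - f (x1, y) - L * RtoC (x2 - x1)%R)%C with
  ((f (x2, y) - L * RtoC x2) - (f (x1, y) - L * RtoC x1))%C by (rewrite RtoC_minus; ring).
apply (mean_value_ineq (fun s => f (s, y) - L * RtoC s)%C (fun s => Fx (s, y) - L)%C); auto.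
intros t ht. destruct (real_diff_derive f (Fx (t, y)) (Fy (t, y)) t y hy) as [h1 h2].
{ apply hd. exact hy. }
split.
- apply (is_derive_ext (fun s => fst (f (s, y)) - s * fst L)).
  { intros s. simpl. ring. }
  apply (is_derive_minus (V := R_NormedModule) (fun s => fst (f (s, y))) (fun s => s * fst L)); auto.
  auto_derive; auto. ring.
- apply (is_derive_ext (fun s => snd (f (s, y)) - s * snd L)).
  { intros s. simpl. ring. }
  apply (is_derive_minus (V := R_NormedModule) (fun s => snd (f (s, y))) (fun s => s * snd L)); auto.
  auto_derive; auto. ring.
Qed.

Definition hquot (f : C -> C) (h : R) (z : C) : C := ((f (z + RtoC h) - f z) / RtoC h)%C.

Lemma hquot_approx (f Fx Fy : C -> C) r eta : 0 < r -> 0 < eta -> C1_on_Hbar f Fx Fy ->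
  exists h, 0 < h /\ forall z, rect (- r) r 0 r z -> Cmod (hquot f h z - Fx z)%C <= eta.
Proof.
intros hr he hC. assert (hcx : contOn inHbar Fx) by (destruct hC as [_ [h _]]; exact h).
(* The rectangle is widened by 1 to the right because [z + h] may leave it; hence also [h <= 1]. *)
destruct (rect_uniform (- r) (r + 1) 0 r Fx) with eta as [d [hd hu]]; auto.
{ intros z hz. apply contAt_subset with inHbar; [|apply hcx; apply hz]. intros w hw. apply hw. }
set (h := Rmin (d / 2) 1). assert (hh : 0 < h) by (apply Rmin_pos; lra).
pose proof (Rmin_l (d / 2) 1) as m1; pose proof (Rmin_r (d / 2) 1) as m2. fold h in m1, m2.
exists h; split; auto. intros z [hz1 hz2].
assert (hi : Cmod (f ((fst z + h)%R, snd z) - f (fst z, snd z) - Fx z * RtoC (fst z + h - fst z)%R)%C <= eta * (fst z + h - fst z)).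
{ apply (increment_approx f Fx Fy); auto; try lra. intros x hx. left. apply hu.
  - split; lra.
  - split; simpl; lra.
  - replace ((x, snd z) - z)%C with (RtoC (x - fst z)) by (apply pair_eq; simpl; ring).
    rewrite Cmod_R, Rabs_pos_eq; lra. }
rewrite <- surjective_pairing in hi. replace (fst z + h - fst z) with h in hi by ring.
replace ((fst z + h)%R, snd z) with (z + RtoC h)%C in hi by (apply pair_eq; simpl; ring).
assert (h0 : RtoC h <> RtoC 0) by (intros e; apply RtoC_inj in e; lra).
unfold hquot. replace ((f (z + RtoC h) - f z) / RtoC h - Fx z)%C
  with ((f (z + RtoC h) - f z - Fx z * RtoC h) / RtoC h)%C by (field; auto).
rewrite Cmod_div, Cmod_R, (Rabs_pos_eq h) by (auto; lra).
apply Rmult_le_reg_r with h; auto. unfold Rdiv. rewrite Rmult_assoc, Rinv_l; lra.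
Qed.

Lemma hquot_hol f h : 0 < h -> hol f inH -> hol (hquot f h) inH.
Proof.
intros hh hf. apply hol_mult; [|apply hol_const]. apply hol_minus; auto.
eapply hol_subset; [|apply hol_shift, hf]. intros z hz. unfold inH, Im in *. simpl. lra.
Qed.

Lemma hquot_cont (f Fx Fy : C -> C) h : C1_on_Hbar f Fx Fy -> contOn inHbar (hquot f h).
Proof.
intros [hd _]. assert (hc : contOn inHbar f).
{ intros z hz. apply real_diff_contAt with (Fx z) (Fy z). apply hd; auto. }
assert (hsh : forall z, inHbar z -> inHbar (z + RtoC h)%C) by (intros z hz; unfold inHbar, Im in *; simpl; lra).
intros z hz. apply contAt_mult; [|apply contAt_const]. apply contAt_minus; [|apply hc; auto].
apply (contAt_comp inHbar inHbar f (fun w => w + RtoC h)%C); auto.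
apply contAt_plus; [apply contAt_id | apply contAt_const].
Qed.

Lemma hquot_neq_0 f h z : 0 < h -> injective_on_H f -> inH z -> hquot f h z <> RtoC 0.
Proof.
intros hh hi hz. assert (h0 : RtoC h <> RtoC 0) by (intros e; apply RtoC_inj in e; lra).
unfold hquot. apply Cmult_neq_0.
- apply Csub_neq_0. intros e. apply hi in e; auto.
  + apply (f_equal fst) in e. simpl in e. lra.
  + unfold inH, Im in *. simpl. lra.
- intros e. apply h0. replace (RtoC h) with (RtoC h * (RtoC h * / RtoC h))%C by (field; auto).
  rewrite e. ring.
Qed.

(** * Growth and boundary bounds for the derivative *)

Lemma fx_hol (f Fx Fy : C -> C) : holomorphic_on_H f -> C1_on_Hbar f Fx Fy ->
  forall z, inH z -> is_cderiv f z (Fx z) /\ contAt full Fx z.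
Proof.
intros hhol hC z hz. split; [apply cderiv_fx with Fy; auto|].
destruct (inH_Copen z hz) as [r [hr hb]]. destruct hC as [_ [hc _]].
apply contAt_locally with inHbar r; auto.
- intros w hw. specialize (hb w hw). unfold inH, inHbar in *. lra.
- exact (hc z (Rlt_le _ _ hz)).
Qed.

Lemma fx_harnack (f Fx Fy : C -> C) : injective_on_H f -> holomorphic_on_H f -> C1_on_Hbar f Fx Fy ->
  forall z w, inH z -> Cmod (w - z)%C <= snd z / 384 -> Cmod (Fx w) <= 23040 * Cmod (Fx z).
Proof.
intros hi hhol hC z w hz hw. unfold inH, Im in hz.
assert (hsub : forall v, osq z (snd z) v -> inH v) by (intros v [_ hv]; unfold inH, Im; lra).
(* The open square whose half-side is the height of [z] lies in the half-plane; half of it as [r]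
   gives [r / 192 = Im z / 384]. *)
apply (koebe_distortion f Fx z (snd z / 2) (snd z)); try lra.
- intros v hv. apply (fx_hol f Fx Fy); auto.
- intros u v hu hv. apply hi; auto.
Qed.

(** The roles of [z] and [w] are exchanged. At distance [Im z / 800] the height of [w] is still at
    least [799/800 * Im z], whose 384th part exceeds that distance. *)
Lemma fx_harnack_inv (f Fx Fy : C -> C) : injective_on_H f -> holomorphic_on_H f -> C1_on_Hbar f Fx Fy ->
  forall z w, inH z -> inH w -> Cmod (w - z)%C <= 1 / 800 * snd z -> Cmod (Fx z) <= 23040 * Cmod (Fx w).
Proof.
intros hi hhol hC z w hz hw hd. apply (fx_harnack f Fx Fy); auto.
rewrite Cmod_sub_sym. pose proof (Rabs_snd_le_Cmod (w - z)%C) as k. unfold inH, Im in *.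
assert (k' : Rabs (snd (w - z)%C) <= 1 / 800 * snd z) by lra.
apply Rabs_le_between in k'. simpl in k'. lra.
Qed.

Lemma fx_neq_0 (f Fx Fy : C -> C) : injective_on_H f -> holomorphic_on_H f -> C1_on_Hbar f Fx Fy ->
  forall z, inH z -> Fx z <> RtoC 0.
Proof.
intros hi hhol hC z hz. apply inj_deriv_neq_0 with f inH; auto.
- apply inH_Copen.
- apply fx_hol with Fy; auto.
Qed.

Lemma fx_upper (f Fx Fy : C -> C) c : injective_on_H f -> holomorphic_on_H f -> C1_on_Hbar f Fx Fy ->
  0 < c -> (forall x, Cmod (Fx (x, 0)) <= c) -> forall z, inH z -> Cmod (Fx z) <= c.
Proof.
intros hi hhol hC hc hb.
destruct (harnack_growth (fun z => Cmod (Fx z)) 23040 (1 / 800)) as [A [p [hA hgr]]]; try lra.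
{ intros; apply Cmod_ge_0. }
{ intros z w hz hw hd. apply (fx_harnack f Fx Fy); auto. unfold inH, Im in hz. lra. }
apply (phragmen_lindelof Fx c A p); auto.
intros r eta hr he. destruct (hquot_approx f Fx Fy r eta) as [h [hh ha]]; auto.
exists (hquot f h). split; [|split]; auto.
- apply contOn_subset with inHbar; [intros w hw; apply hw | apply hquot_cont with Fx Fy; auto].
- apply hquot_hol; auto. exists Fx. apply fx_hol with Fy; auto.
Qed.

Lemma fx_lower (f Fx Fy : C -> C) c : injective_on_H f -> holomorphic_on_H f -> C1_on_Hbar f Fx Fy ->
  0 < c -> (forall x, c <= Cmod (Fx (x, 0))) -> forall z, inH z -> c <= Cmod (Fx z).
Proof.
intros hi hhol hC hc hb.
assert (hne := fx_neq_0 f Fx Fy hi hhol hC).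
assert (hneb : forall z, inHbar z -> Fx z <> RtoC 0).
{ intros z hz. destruct (Req_dec (snd z) 0) as [e|e].
  - apply Cmod_gt_0. rewrite (surjective_pairing z), e. eapply Rlt_le_trans; [apply hc | apply hb].
  - apply hne. unfold inH, inHbar, Im in *. lra. }
assert (hmain : forall z, inH z -> Cmod (/ Fx z)%C <= / c).
{ destruct (harnack_growth (fun z => Cmod (/ Fx z)%C) 23040 (1 / 800)) as [A [p [hA hgr]]]; try lra.
  { intros; apply Cmod_ge_0. }
  { intros z w hz hw hd. rewrite !Cmod_inv by auto.
    pose proof (fx_harnack_inv f Fx Fy hi hhol hC z w hz hw hd) as k.
    pose proof (hne z hz) as z0; apply Cmod_gt_0 in z0. pose proof (hne w hw) as w0; apply Cmod_gt_0 in w0.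
    apply Rmult_le_reg_r with (Cmod (Fx w)); auto. rewrite Rinv_l by lra.
    apply Rmult_le_reg_r with (Cmod (Fx z)); auto.
    replace (23040 * / Cmod (Fx z) * Cmod (Fx w) * Cmod (Fx z)) with (23040 * Cmod (Fx w)) by (field; lra). lra. }
  apply (phragmen_lindelof (fun z => / Fx z)%C (/ c) A p); auto.
  - apply Rinv_0_lt_compat; auto.
  - intros r eta hr he.
    assert (hcx : contOn (rect (- r) r 0 r) Fx).
    { destruct hC as [_ [h _]]. apply contOn_subset with inHbar; [intros w hw; apply hw | exact h]. }
    (* By compactness [|Fx|] is at least [/ M] on the closed rectangle: on the real axis it is
       nonzero by the boundary hypothesis, above it by injectivity. *)
    destruct (rect_max (- r) r 0 r (fun z => Cmod (/ Fx z)%C)) as [z0 [hz0 hmax]]; try lra.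
    { intros z hz. apply (contAt_Cmod _ (fun w => / Fx w)%C). apply contAt_Cinv; auto. apply hneb, hz. }
    set (M := Cmod (/ Fx z0)%C) in *.
    assert (hM : 0 < M).
    { unfold M. rewrite Cmod_inv by (apply hneb, hz0). apply Rinv_0_lt_compat, Cmod_gt_0, hneb, hz0. }
    (* The first tolerance keeps [|hquot| >= / (2 * M)]; with it, the second bounds the difference
       of the reciprocals by [eta / (2 * M * M) * (2 * M * M) = eta]. *)
    destruct (hquot_approx f Fx Fy r (Rmin (/ (2 * M)) (eta / (2 * M * M)))) as [h [hh ha]]; auto.
    { apply Rmin_pos; [apply Rinv_0_lt_compat; lra | apply Rdiv_lt_0_compat; nra]. }
    pose proof (Rmin_l (/ (2 * M)) (eta / (2 * M * M))) as m1; pose proof (Rmin_r (/ (2 * M)) (eta / (2 * M * M))) as m2.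
    assert (hfl : forall z, rect (- r) r 0 r z -> / M <= Cmod (Fx z)).
    { intros z hz. specialize (hmax z hz). assert (h0 := hneb z ltac:(apply hz)). rewrite Cmod_inv in hmax by auto.
      apply Cmod_gt_0 in h0.
      rewrite <- (Rinv_inv (Cmod (Fx z))). apply Rinv_le_contravar; auto. apply Rinv_0_lt_compat; auto. }
    assert (hql : forall z, rect (- r) r 0 r z -> / (2 * M) <= Cmod (hquot f h z)).
    { intros z hz. specialize (hfl z hz). specialize (ha z hz).
      pose proof (Cmod_triangle_sub (Fx z) (hquot f h z)) as t. rewrite Cmod_sub_sym in t.
      replace (/ M) with (/ (2 * M) + / (2 * M)) in hfl by (field; lra). lra. }
    assert (hM2 : 0 < / (2 * M)) by (apply Rinv_0_lt_compat; lra).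
    assert (hq0 : forall z, rect (- r) r 0 r z -> hquot f h z <> RtoC 0).
    { intros z hz. apply Cmod_gt_0. specialize (hql z hz). lra. }
    exists (fun z => / hquot f h z)%C. split; [|split].
    + intros z hz. apply contAt_Cinv; auto.
      apply (contOn_subset inHbar); [intros w hw; apply hw | apply hquot_cont with Fx Fy; auto | auto].
    + apply hol_inv; [|intros; apply hquot_neq_0; auto].
      apply hquot_hol; auto. exists Fx. apply fx_hol with Fy; auto.
    + intros z hz. assert (h0 := hneb z ltac:(apply hz)). specialize (hq0 z hz). specialize (hql z hz).
      specialize (hfl z hz). specialize (ha z hz).
      replace (/ hquot f h z - / Fx z)%C with (- (hquot f h z - Fx z) * (/ hquot f h z * / Fx z))%C by (field; auto).
      rewrite !Cmod_mult, Cmod_opp, !Cmod_inv by auto.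
      apply Cmod_gt_0 in h0. apply Cmod_gt_0 in hq0.
      apply Rle_trans with (eta / (2 * M * M) * (2 * M * M)); [|right; field; lra].
      assert (i1 : / Cmod (hquot f h z) <= 2 * M).
      { rewrite <- (Rinv_inv (2 * M)). apply Rinv_le_contravar; auto. }
      assert (i2 : / Cmod (Fx z) <= M).
      { rewrite <- (Rinv_inv M). apply Rinv_le_contravar; auto. apply Rinv_0_lt_compat; auto. }
      apply Rmult_le_compat; [apply Cmod_ge_0 | | lra |].
      * apply Rmult_le_pos; left; apply Rinv_0_lt_compat; auto.
      * apply Rmult_le_compat; auto; left; apply Rinv_0_lt_compat; auto.
  - intros x. assert (k := hb x). rewrite Cmod_inv.
    + apply Rinv_le_contravar; auto.
    + apply Cmod_gt_0. lra. }
intros z hz. specialize (hmain z hz). assert (h0 := hne z hz). rewrite Cmod_inv in hmain by auto.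
apply Cmod_gt_0 in h0. apply Rinv_le_contravar in hmain; [|apply Rinv_0_lt_compat; auto].
rewrite !Rinv_inv in hmain. auto.
Qed.

(* f' on the real line := derivative of the Cplx^1 extension along R, i.e. Fx (x,0). *)
Theorem mainTheorem12 (f Fx Fy : Cplx -> Cplx) (c : R)
  (hinj : injective_on_H f) (hhol : holomorphic_on_H f)
  (hC1 : C1_on_Hbar f Fx Fy) (hc : 0 < c) :
  ((forall x : R, Cnorm (Fx (x, 0)) <= c) ->
     forall z L, inH z -> is_cderiv f z L -> Cnorm L <= c) /\
  ((forall x : R, c <= Cnorm (Fx (x, 0))) ->
     forall z L, inH z -> is_cderiv f z L -> c <= Cnorm L) /\
  ((exists k : R, forall x : R, Cnorm (Fx (x, 0)) = k) ->
     exists L0 : Cplx, forall z L, inH z -> is_cderiv f z L -> L = L0).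
Proof.
assert (hfx := fx_hol f Fx Fy hhol hC1).
assert (hL : forall z L, inH z -> is_cderiv f z L -> L = Fx z).
{ intros z L hz h. apply (cderiv_unique f z); auto. apply hfx, hz. }
split; [|split].
- intros hb z L hz h. rewrite (hL z L hz h). apply (fx_upper f Fx Fy c); auto.
- intros hb z L hz h. rewrite (hL z L hz h). apply (fx_lower f Fx Fy c); auto.
- intros [k hk]. destruct (Rle_lt_dec k 0) as [hk0|hk0].
  (* [fx_upper] asks for a positive bound, so [k <= 0] is treated as the limit of the bounds
     [eps > 0], which gives [Fx z = 0]. *)
  + exists (RtoC 0). intros z L hz h. rewrite (hL z L hz h). apply Cmod_eq_0.
    apply Rle_antisym; [|apply Cmod_ge_0]. apply le_epsilon. intros eps he. rewrite Rplus_0_l.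
    apply (fx_upper f Fx Fy eps); auto. intros x.
    change (Cnorm (Fx (x, 0)) <= eps). rewrite hk. lra.
  + exists (Fx (0, 1)). intros z L hz h. rewrite (hL z L hz h).
    apply (const_modulus_deriv f Fx k); auto.
    * intros w hw. apply Rle_antisym.
      -- apply (fx_upper f Fx Fy k); auto. intros x. right. apply hk.
      -- apply (fx_lower f Fx Fy k); auto. intros x. right. symmetry. apply hk.
    * unfold inH, Im. simpl. lra.
Qed.
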